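(* Let $K\subset\mathbb R^2$ be a triangle with vertices $\mathbf P_1,\mathbf P_2,\mathbf P_3$, let $e$ be the edge $\mathbf P_1\mathbf P_2$, let $h_K$ be the length of the longest edge of $K$, and let $H_K=2|K|/|e|$ be the height of $K$ with respect to $e$. Then for every $u\in H^1(K)$, $$\|u-\Pi_hu\|_{0,e}\le 0.6711\,\frac{h_K}{\sqrt{H_K}}\,|u-\Pi_hu|_{1,K}.$$
   Context: $\Pi_h u$ denotes the Crouzeix--Raviart interpolation of $u$ on $K$: the unique linear polynomial on $K$ satisfying $\int_{e_i}\Pi_hu\,\mathrm ds=\int_{e_i}u\,\mathrm ds$ for each of the three edges $e_1,e_2,e_3$ of $K$ (traces understood in the $L^2$ sense). $\|\cdot\|_{0,e}$ is the $L^2(e)$ norm, $|\cdot|_{1,K}=\|\nabla\cdot\|_{L^2(K)}$ is the $H^1$ seminorm on $K$, and $|K|$, $|e|$ denote the area of $K$ and the length of $e$. *)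

(* Defs.v *)
From HB Require Import structures.
From mathcomp Require Import all_boot all_order all_algebra.
From mathcomp Require Import all_classical all_reals all_analysis.
Set Implicit Arguments. Unset Strict Implicit. Unset Printing Implicit Defensive.
Import Order.TTheory GRing.Theory Num.Theory.
Import numFieldNormedType.Exports.
Local Open Scope classical_set_scope.
Local Open Scope ring_scope.

Section Defs.
Context {R : realType}.

Definition pt := (R * R)%type.

Definition leb1 := (@lebesgue_measure R).
Definition leb2 := (leb1 \x leb1)%E.

Definition len (A B : pt) : R :=
  Num.sqrt ((B.1 - A.1) ^+ 2 + (B.2 - A.2) ^+ 2).

Definition det3 (P1 P2 P3 : pt) : R :=
  (P2.1 - P1.1) * (P3.2 - P1.2) - (P3.1 - P1.1) * (P2.2 - P1.2).

Definition area (P1 P2 P3 : pt) : R := `|det3 P1 P2 P3| / 2.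

Definition triangle (P1 P2 P3 : pt) : set pt :=
  [set x | exists l1 l2 l3 : R, [/\ 0 < l1, 0 < l2, 0 < l3, l1 + l2 + l3 = 1 &
      x = (l1 * P1.1 + l2 * P2.1 + l3 * P3.1, l1 * P1.2 + l2 * P2.2 + l3 * P3.2)]].

Definition seg (A B : pt) (s : R) : pt :=
  (A.1 + s * (B.1 - A.1), A.2 + s * (B.2 - A.2)).

(* line integral over the edge AB of a function given in the parameter s:
   \int_e w ds = |e| \int_0^1 w(s) ds *)
Definition line_int (A B : pt) (w : R -> R) : \bar R :=
  ((len A B)%:E * \int[leb1]_(s in `[0%R, 1%R]) (w s)%:E)%E.

Definition dx (f : pt -> R) (x : pt) : R := 'D_((1 : R), (0 : R)) f x.
Definition dy (f : pt -> R) (x : pt) : R := 'D_((0 : R), (1 : R)) f x.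

Fixpoint iterD (vs : seq pt) (f : pt -> R) : pt -> R :=
  match vs with
  | [::] => f
  | v :: vs' => 'D_v (iterD vs' f)
  end.

Definition smooth (f : pt -> R) : Prop :=
  forall vs : seq pt,
    continuous (iterD vs f) /\ forall (x v : pt), derivable (iterD vs f) x v.

Definition test_fun (K : set pt) (phi : pt -> R) : Prop :=
  smooth phi /\
  exists C : set pt, [/\ compact C, C `<=` K & forall x, ~ C x -> phi x = 0].

Definition L2 (K : set pt) (f : pt -> R) : Prop :=
  measurable_fun K f /\ (\int[leb2]_(x in K) ((f x) ^+ 2)%:E < +oo)%E.

Definition H1_weak_grad (K : set pt) (u g1 g2 : pt -> R) : Prop :=
  [/\ L2 K u, L2 K g1, L2 K g2 &
   forall phi, test_fun K phi ->
     (\int[leb2]_(x in K) (u x * dx phi x)%:E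
        = - \int[leb2]_(x in K) (g1 x * phi x)%:E)%E /\
     (\int[leb2]_(x in K) (u x * dy phi x)%:E
        = - \int[leb2]_(x in K) (g2 x * phi x)%:E)%E].

(* t (a function of the edge parameter s in [0,1]) is the L^2 trace on the
   edge AB of u \in H^1(K) (weak gradient (g1,g2)): the L^2(e)-limit of the
   restrictions to e of smooth functions converging to u in H^1(K). *)
Definition is_trace (K : set pt) (u g1 g2 : pt -> R) (A B : pt) (t : R -> R)
  : Prop :=
  [/\ measurable_fun (`[0%R, 1%R] : set R) t,
      (\int[leb1]_(s in `[0%R, 1%R]) ((t s) ^+ 2)%:E < +oo)%E &
      exists un : nat -> pt -> R,
        [/\ forall n, smooth (un n),
            (fun n => \int[leb2]_(x in K)
                 ((un n x - u x) ^+ 2 + (dx (un n) x - g1 x) ^+ 2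
                  + (dy (un n) x - g2 x) ^+ 2)%:E)%E @ \oo --> 0%E &
            (fun n => \int[leb1]_(s in `[0%R, 1%R])
                 ((un n (seg A B s) - t s) ^+ 2)%:E)%E @ \oo --> 0%E]].

Definition lin (c0 a b : R) (x : pt) : R := c0 + a * x.1 + b * x.2.

End Defs.

(* Main.v *)
Require Import Defs.
From HB Require Import structures.
From mathcomp Require Import all_boot all_order all_algebra.
From mathcomp Require Import all_classical all_reals all_analysis.
From mathcomp Require Import measurable_realfun ring lra.
Import Order.TTheory GRing.Theory Num.Theory.
Import numFieldNormedType.Exports.
Local Open Scope classical_set_scope.
Local Open Scope ring_scope.

(** Put [w = u - Pi_h u]. Its mean over [e] vanishes, so its squared norm on [e] is
the length of [e] times the variance of its trace, and it suffices to bound that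
variance with a constant [9/20 < 0.6711^2].

Let [g] be the gradient of [w], write the points of [K] as
[P3 + r (P(s) - P3)] with [P(s)] on [e], and let [eps = (P2 - P1).g] and
[d = (P(s) - P3).g]. The three edges have length at most [h], which confines
[(P2 - P3).g] and [(P3 - P1).g] to a hexagon, and gives
[9/10 d^2 + (1 - 9/10 max(s, 1-s)^2) eps^2 <= h^2 |g|^2].

For smooth [w] the variance [V(r)] of [s |-> w(r, s)] has derivative
[2 Cov_s(w, d)]. Young's inequality, the previous bound and the weighted Poincare
inequality [4000/729 Var f <= \int (1 - 9/10 max(s, 1-s)^2) f'^2] on [[0, 1]]
give [V'(r) <= 9/20 h^2 r \int |g|^2 ds]. Since [V(0) = 0] and [dx = |det| r dr ds],
integrating in [r] bounds the variance [V(1)] of the trace. The slack between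
[9/20] and [0.6711^2] absorbs the passage from smooth functions to [H^1]. *)

Local Notation mu := lebesgue_measure.

(** * Calculus on an interval *)

Lemma is_derive1_continuous {R : realType} (f : R -> R) (x l : R) :
  is_derive x 1 f l -> {for x, continuous f}.
Proof.
move=> [df _].
by apply: differentiable_continuous; exact/derivable1_diffP.
Qed.

Lemma continuous_itv_integrable {R : realType} (f : R -> R) (a b : R) :
  (forall x, a <= x <= b -> {for x, continuous f}) ->
  mu.-integrable `[a, b] (EFin \o f).
Proof.
move=> cf; apply: continuous_compact_integrable; first exact: segment_compact.
apply: continuous_in_subspaceT => x; rewrite inE/= in_itv/=; exact: cf.
Qed.

(** The base point [a] lies strictly below the range in use, so the derivative there is two-sided;
    later [a = -1] covers all of [0, 1], end points included. *)
Lemma antiderivative_exists {R : realType} (f : R -> R) (a : R) : continuous f ->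
  exists F : R -> R, forall x, a < x -> is_derive x 1 F (f x).
Proof.
move=> cf; exists (fun x => \int[mu]_(t in `[a, x]) f t) => x ax.
have [|||//|dF F'] := @continuous_FTC1 R f (BLeft a) x (x + 1).
- by rewrite ltrDl.
- by apply: continuous_itv_integrable => y _; exact: cf.
- by rewrite lte_fin.
- exact: cf.
by apply: DeriveDef => //; rewrite -derive1E.
Qed.

Lemma Rintegral_FTC2 {R : realType} (f F : R -> R) (a b : R) : a <= b ->
  (forall x, a <= x <= b -> {for x, continuous f}) ->
  (forall x, a <= x <= b -> is_derive x 1 F (f x)) ->
  \int[mu]_(x in `[a, b]) f x = F b - F a.
Proof.
rewrite le_eqVlt => /orP[/eqP <- _ _|ab cf dF].
  by rewrite set_itv1 Rintegral_set1 subrr.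
have cF x : a <= x <= b -> {for x, continuous F}.
  by move=> /dF; exact: is_derive1_continuous.
rewrite /Rintegral (@continuous_FTC2 _ f F a b) //.
- by apply: continuous_in_subspaceT => x; rewrite inE/= in_itv/=; exact: cf.
- split.
  + move=> x; rewrite in_itv/= => /andP[/ltW ax /ltW xb].
    by have [] := dF x; rewrite ?ax.
  + by apply: cvg_at_right_filter; apply: cF; rewrite lexx ltW.
  + by apply: cvg_at_left_filter; apply: cF; rewrite lexx ltW.
- move=> x; rewrite in_itv/= => /andP[/ltW ax /ltW xb].
  by have [|_ <-] := dF x; rewrite ?ax// derive1E.
Qed.

Lemma derive_ge0_le {R : realType} (f f' : R -> R) (a b : R) : a <= b ->
  (forall x, a <= x <= b -> is_derive x 1 f (f' x)) ->
  (forall x, a < x < b -> 0 <= f' x) -> f a <= f b.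
Proof.
rewrite le_eqVlt => /predU1P[->//|ab] df f'0.
have cf : {within `[a, b], continuous f}.
  apply: continuous_in_subspaceT => x; rewrite inE/= in_itv/= => /df.
  exact: is_derive1_continuous.
have [|c cab E] := @MVT R f f' a b ab _ cf.
  move=> x; rewrite in_itv/= => /andP[/ltW ax /ltW xb].
  by apply: df; rewrite ax.
rewrite -subr_ge0 E mulr_ge0//; last by rewrite subr_ge0 ltW.
by apply: f'0; move: cab; rewrite in_itv.
Qed.

Lemma le_Rintegral_continuous {R : realType} (f g : R -> R) (a b : R) :
  (forall x, a <= x <= b -> {for x, continuous f}) ->
  (forall x, a <= x <= b -> {for x, continuous g}) ->
  (forall x, a <= x <= b -> f x <= g x) ->
  \int[mu]_(x in `[a, b]) f x <= \int[mu]_(x in `[a, b]) g x.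
Proof.
by move=> cf cg fg; apply: le_Rintegral => //; exact: continuous_itv_integrable.
Qed.

(** With [psi'' = - phi], this is the supersolution inequality for the trial weight of
    [half_interval_hardy]. Both sides have degree 6, and [lra] derives the bound from the
    nonnegativity of the Bernstein products of that degree on each of four subintervals. *)
Lemma weight_ge {R : realType} (y : R) : 0 <= y <= 2^-1 ->
  4000 / 729 * (25 / 96 - y ^+ 2 - y ^+ 4 / 2 + 4 / 3 * y ^+ 6) <=
  (1 - 9 / 10 * (2^-1 + y) ^+ 2) * (2 + 6 * y ^+ 2 - 40 * y ^+ 4).
Proof.
move=> /andP[y0 y1].
pose bernstein (a b : R) := forall i : nat, 0 <= (y - a) ^+ i * (b - y) ^+ (6 - i).
have bge0 a b : a <= y <= b -> bernstein a b.
  by move=> /andP[ay yb] i; rewrite mulr_ge0// exprn_ge0// subr_ge0.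
have [a1|/ltW a1] := lerP y (1 / 8).
  have B := bge0 0 (1 / 8); have /B {}B : 0 <= y <= 1 / 8 by rewrite y0.
  move: (B 0%N) (B 1%N) (B 2%N) (B 3%N) (B 4%N) (B 5%N) (B 6%N) => /=.
  by rewrite /subn/=; lra.
have [a2|/ltW a2] := lerP y (1 / 4).
  have /bge0 B : 1 / 8 <= y <= 1 / 4 by rewrite a1.
  move: (B 0%N) (B 1%N) (B 2%N) (B 3%N) (B 4%N) (B 5%N) (B 6%N) => /=.
  by rewrite /subn/=; lra.
have [a3|/ltW a3] := lerP y (3 / 8).
  have /bge0 B : 1 / 4 <= y <= 3 / 8 by rewrite a2.
  move: (B 0%N) (B 1%N) (B 2%N) (B 3%N) (B 4%N) (B 5%N) (B 6%N) => /=.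
  by rewrite /subn/=; lra.
have /bge0 B : 3 / 8 <= y <= 2^-1 by rewrite a3.
move: (B 0%N) (B 1%N) (B 2%N) (B 3%N) (B 4%N) (B 5%N) (B 6%N) => /=.
by rewrite /subn/=; lra.
Qed.

(** * Derivatives and continuity of pointwise expressions *)

Section pointwise_derive.
Context {R : realType} {V : normedModType R}.
Implicit Types (f g : V -> R) (x v : V).

Lemma is_derive_add f g x v (df dg : R) :
  is_derive x v f df -> is_derive x v g dg ->
  is_derive x v (fun y => f y + g y) (df + dg).
Proof. by move=> Hf Hg; exact: (is_deriveD Hf Hg). Qed.

Lemma is_derive_sub f g x v (df dg : R) :
  is_derive x v f df -> is_derive x v g dg ->
  is_derive x v (fun y => f y - g y) (df - dg).
Proof. by move=> Hf Hg; exact: (is_deriveB Hf Hg). Qed.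

Lemma is_derive_mul f g x v (df dg : R) :
  is_derive x v f df -> is_derive x v g dg ->
  is_derive x v (fun y => f y * g y) (f x * dg + g x * df).
Proof. by move=> Hf Hg; exact: (is_deriveM Hf Hg). Qed.

Lemma is_derive_scale (k : R) f x v (df : R) :
  is_derive x v f df -> is_derive x v (fun y => k * f y) (k * df).
Proof. by move=> Hf; exact: (is_deriveZ k Hf). Qed.

Lemma is_derive_exp f n x v (df : R) :
  is_derive x v f df ->
  is_derive x v (fun y => f y ^+ n.+1) (n.+1%:R * f x ^+ n * df).
Proof.
move=> Hf.
have -> : (fun y => f y ^+ n.+1) = f ^+ n.+1.
  apply/funext => y; elim: n => [|n IH]; first by rewrite !expr1.
  by rewrite exprS IH [in RHS]exprS.
apply: (is_derive_eq (is_deriveX n.+1 Hf)).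
by [].
Qed.
End pointwise_derive.

Lemma continuous_pow {R : realType} {V : topologicalType} (f : V -> R) (n : nat) x :
  {for x, continuous f} -> {for x, continuous (fun y => f y ^+ n)}.
Proof.
move=> cf; elim: n => [|n IH].
  have -> : (fun y => f y ^+ 0) = cst 1 by apply/funext => y; rewrite expr0.
  exact: cvg_cst.
have -> : (fun y => f y ^+ n.+1) = (fun y => f y * f y ^+ n).
  by apply/funext => y; rewrite exprS.
exact: continuousM.
Qed.

Lemma continuous_pair {T U V : topologicalType} (f : T -> U) (g : T -> V) x :
  {for x, continuous f} -> {for x, continuous g} ->
  {for x, continuous (fun y => (f y, g y))}.
Proof. by move=> cf cg; exact: cvg_pair. Qed.

(** Hypotheses are tried first, so that functions known to be continuous are not decomposed. The
    cases [+%R], [*%R] and [-%R] catch eta-reduced maps. Matching is syntactic, which is why many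
    facts below have the form [forall x, {for x, continuous f}]. *)
Ltac solve_cont :=
  repeat match goal with
  | |- forall x, {for x, continuous _} => move=> ?
  | H : {for ?x, continuous ?f} |- {for ?x, continuous ?f} => exact: H
  | H : continuous ?f |- {for ?x, continuous ?f} => exact: H
  | H : forall y, {for y, continuous ?f} |- {for ?x, continuous ?f} => exact: H
  | |- {for ?x, continuous (fun=> _)} => exact: cvg_cst
  | |- {for ?x, continuous (fun y => y)} => exact: cvg_id
  | |- {for ?x, continuous fst} => exact: cvg_fst
  | |- {for ?x, continuous snd} => exact: cvg_snd
  | |- {for ?x, continuous (fun y => y.1)} => exact: cvg_fst
  | |- {for ?x, continuous (fun y => y.2)} => exact: cvg_snd
  | |- {for ?x, continuous (fun y => (_, _))} => apply: continuous_pair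
  | |- {for ?x, continuous (+%R ?a)} =>
      apply: (@continuousD _ _ _ (fun=> a) (fun y => y))
  | |- {for ?x, continuous ( *%R ?a)} =>
      apply: (@continuousM _ _ (fun=> a) (fun y => y))
  | |- {for ?x, continuous (fun y => _ + _)} => apply: continuousD
  | |- {for ?x, continuous (-%R)} =>
      apply: (@continuousN _ _ _ (fun y => y))
  | |- {for ?x, continuous (fun y => - _)} => apply: continuousN
  | |- {for ?x, continuous (fun y => _ * _)} => apply: continuousM
  | |- {for ?x, continuous (fun y => _ ^+ _)} => apply: continuous_pow
  end.

(** * A weighted Poincare inequality *)

(** Cauchy-Schwarz with the weight [phi] gives [(w y - w 0)^2 <= Phi y * I y], where [I] is the
    primitive of [w'^2 / phi]. Integration by parts turns the integral of [Phi I] into that of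
    [psi w'^2 / phi], and [weight_ge] compares this with the weighted energy. *)
Lemma half_interval_hardy {R : realType} (w w' : R -> R) :
  (forall y : R, is_derive y 1 w (w' y)) -> continuous w' ->
  0 <= \int[mu]_(y in `[0, 2^-1])
    ((1 - 9 / 10 * (2^-1 + y) ^+ 2) * w' y ^+ 2
     - 4000 / 729 * (w y - w 0) ^+ 2).
Proof.
move=> dw cw'.
have cw : continuous w by move=> y; exact: is_derive1_continuous (dw y).
(* Phi' = phi, psi' = - Phi and psi (1/2) = 0; the coefficients of the trial weight
   phi were found numerically so that weight_ge holds *)
pose phi (y : R) := 2 + 6 * y ^+ 2 - 40 * y ^+ 4.
pose Phi (y : R) := 2 * y + 2 * y ^+ 3 - 8 * y ^+ 5.
pose psi (y : R) := 25 / 96 - y ^+ 2 - y ^+ 4 / 2 + 4 / 3 * y ^+ 6.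
have sq4 (y : R) : 0 <= y <= 2^-1 -> 0 <= 1 - 4 * y ^+ 2 by move=> /andP[]; nra.
have phi1 (y : R) : 0 <= y <= 2^-1 -> 1 <= phi y.
  move=> /sq4 y4; rewrite -subr_ge0.
  have -> : phi y - 1 = (1 - 4 * y ^+ 2) * (1 + 10 * y ^+ 2) by rewrite /phi; ring.
  by rewrite mulr_ge0// addr_ge0// mulr_ge0// sqr_ge0.
have PhiE y : Phi y = 2 * y * (1 + y ^+ 2 * (1 - 4 * y ^+ 2)).
  by rewrite /Phi; ring.
have dPhi (y : R) : is_derive y 1 Phi (phi y).
  by apply: is_derive_eq; rewrite /GRing.scale/= /phi; ring.
have dpsi (y : R) : is_derive y 1 psi (- Phi y).
  by apply: is_derive_eq; rewrite /GRing.scale/= /Phi; field.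
have cphi : forall y, {for y, continuous phi} by move=> y; rewrite /phi; solve_cont.
(* On [0, 1/2] [phi] is at least 1, but not on the whole line; truncation from below makes [f]
   continuous everywhere, as [antiderivative_exists] demands. *)
pose f y := w' y ^+ 2 / Num.max (phi y) 1.
have cf : forall y, {for y, continuous f}.
  move=> y; rewrite /f; apply: continuousM; first by solve_cont.
  apply: continuousV; first by rewrite gt_eqF// lt_max ltr01 orbT.
  by apply: continuous_max => //; solve_cont.
have fE (y : R) : 0 <= y <= 2^-1 -> f y * phi y = w' y ^+ 2.
  move=> /phi1 y1; rewrite /f max_l// divfK// gt_eqF//.
  exact: lt_le_trans y1.
have [I0 dI0] := @antiderivative_exists R f (-1) cf.
pose I y := I0 y - I0 0.
have dI (y : R) : 0 <= y <= 2^-1 -> is_derive y 1 I (f y).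
  move=> /andP[y0 _].
  have dy : is_derive y 1 I0 (f y) by apply: dI0; rewrite (lt_le_trans _ y0)// ltrN10.
  by apply: is_derive_eq; rewrite subr0.
have cI (y : R) : 0 <= y <= 2^-1 -> {for y, continuous I}.
  by move=> /dI; exact: is_derive1_continuous.
have f0 (y : R) : 0 <= f y.
  by rewrite divr_ge0 ?sqr_ge0// le_max ler01 orbT.
(* Cauchy-Schwarz for w y - w 0 = \int_0^y w', with weight phi *)
have CS (y : R) : 0 <= y <= 2^-1 -> (w y - w 0) ^+ 2 <= Phi y * I y.
  move=> /andP[y0 y1].
  have sub (x : R) : 0 <= x <= y -> 0 <= x <= 2^-1.
    by move=> /andP[-> xy]; exact: le_trans y1.
  have y4 := sq4 y; rewrite y0 y1 in y4; have {}y4 := y4 isT.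
  have I_ge0 : 0 <= I y.
    have -> : 0 = I 0 by rewrite /I subrr.
    apply: (@derive_ge0_le _ I f 0 y y0) => // x xy; exact: dI (sub _ xy).
  have [->|e0] := eqVneq (w y - w 0) 0; first rewrite expr0n/= PhiE.
    by rewrite !mulr_ge0// addr_ge0// mulr_ge0// sqr_ge0.
  (* Since [l^2 f - 2 l w' + phi = (l w' - phi)^2 / phi], the expression
     [l^2 I - 2 l (w - w 0) + Phi] is nonnegative at [y] for every [l]. This choice gives
     [l (w y - w 0) = Phi y] and avoids a division by [I y], which is only known to be
     nonnegative. *)
  pose l := Phi y / (w y - w 0).
  have : l ^+ 2 * I 0 - 2 * l * w 0 + Phi 0 <= l ^+ 2 * I y - 2 * l * w y + Phi y.
    pose G x := l ^+ 2 * I x - 2 * l * w x + Phi x.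
    pose g x := l ^+ 2 * f x - 2 * l * w' x + phi x.
    rewrite -[leLHS]/(G 0) -[leRHS]/(G y); apply: (@derive_ge0_le _ G g 0 y y0).
      move=> x /sub x01.
      exact: (is_derive_add _ _ _ _ _ _ (is_derive_sub _ _ _ _ _ _
        (is_derive_scale (l ^+ 2) _ _ _ _ (dI x x01))
        (is_derive_scale (2 * l) _ _ _ _ (dw x))) (dPhi x)).
    move=> x /andP[/ltW x0 /ltW xy].
    have {x0 xy} /sub x01 : 0 <= x <= y by rewrite x0.
    rewrite /g.
    have p0 : 0 < phi x by apply: lt_le_trans (phi1 _ x01).
    rewrite -(pmulr_lge0 _ p0).
    have -> : (l ^+ 2 * f x - 2 * l * w' x + phi x) * phi x =
      l ^+ 2 * (f x * phi x) - 2 * l * w' x * phi x + phi x ^+ 2 by ring.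
    rewrite fE//.
    have -> : l ^+ 2 * w' x ^+ 2 - 2 * l * w' x * phi x + phi x ^+ 2 =
      (l * w' x - phi x) ^+ 2 by ring.
    exact: sqr_ge0.
  rewrite {1}/I subrr mulr0 /Phi !expr0n/= !mulr0 -/(Phi y) => H.
  have {}H : 0 <= l ^+ 2 * I y - 2 * l * (w y - w 0) + Phi y.
    by move: H; lra.
  have le : l * (w y - w 0) = Phi y by rewrite /l divfK.
  have {}H : Phi y <= l ^+ 2 * I y by move: H; rewrite -mulrA le; lra.
  have Pp : 0 < Phi y.
    have yp : 0 < y.
      by rewrite lt_def y0 andbT; apply: contraNneq e0 => ->; rewrite subrr.
    by rewrite PhiE !mulr_gt0// ltr_pwDl// mulr_ge0 ?sqr_ge0.
  have : Phi y * (w y - w 0) ^+ 2 <= l ^+ 2 * I y * (w y - w 0) ^+ 2.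
    by rewrite ler_wpM2r ?sqr_ge0.
  have -> : l ^+ 2 * I y * (w y - w 0) ^+ 2 = Phi y * (Phi y * I y).
    by rewrite -le; ring.
  by rewrite ler_pM2l.
(* [J] is the derivative of [4000/729 psi I], which vanishes at both ends because [I 0 = 0] and
   [psi (1/2) = 0]. It is therefore enough to bound the integrand below by [J] pointwise. *)
pose J y := 4000 / 729 * (psi y * f y + I y * - Phi y).
have cJ y : 0 <= y <= 2^-1 -> {for y, continuous J}.
  move=> y01; apply: continuousM; first exact: cvg_cst.
  apply: continuousD; apply: continuousM.
  - exact: is_derive1_continuous (dpsi y).
  - exact: cf.
  - exact: cI.
  - by apply: continuousN; exact: is_derive1_continuous (dPhi y).
have E0 : \int[mu]_(y in `[0, 2^-1]) J y = 0.
  have h0 : (0 : R) <= 2^-1 by rewrite invr_ge0.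
  have dJ (y : R) : 0 <= y <= 2^-1 ->
      is_derive y 1 (fun y => 4000 / 729 * (psi y * I y)) (J y).
    move=> y01; exact: (is_derive_scale (4000 / 729) _ _ _ _
      (is_derive_mul _ _ _ _ _ _ (dpsi y) (dI y y01))).
  rewrite (Rintegral_FTC2 _ _ _ _ h0 cJ dJ).
  by rewrite /I subrr /psi; field.
pose H y := (1 - 9 / 10 * (2^-1 + y) ^+ 2) * w' y ^+ 2 - 4000 / 729 * (w y - w 0) ^+ 2.
have cH y : 0 <= y <= 2^-1 -> {for y, continuous H} by move=> _; rewrite /H; solve_cont.
rewrite -[leLHS]E0; apply: (@le_Rintegral_continuous R J H 0 2^-1 cJ cH) => y y01.
have A : 4000 / 729 * psi y * f y <= (1 - 9 / 10 * (2^-1 + y) ^+ 2) * w' y ^+ 2.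
  have := ler_wpM2r (f0 y) (weight_ge _ y01).
  by rewrite -/(psi y) -/(phi y) -[leRHS]mulrA [phi y * f y]mulrC fE.
have B := CS _ y01.
by rewrite /J /H; move: A B; lra.
Qed.

Lemma Rintegral_itv_lin {R : realType} (f g : R -> R) (a b k l : R) :
  continuous f -> continuous g ->
  \int[mu]_(x in `[a, b]) (k * f x + l * g x) =
  k * \int[mu]_(x in `[a, b]) f x + l * \int[mu]_(x in `[a, b]) g x.
Proof.
move=> cf cg.
have If : mu.-integrable `[a, b] (EFin \o f).
  by apply: continuous_itv_integrable => x _; exact: cf.
have Ig : mu.-integrable `[a, b] (EFin \o g).
  by apply: continuous_itv_integrable => x _; exact: cg.
rewrite RintegralD//; first by rewrite !RintegralZl.
- by apply: continuous_itv_integrable => x _; solve_cont.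
- by apply: continuous_itv_integrable => x _; solve_cont.
Qed.

Lemma Rintegral01_cst {R : realType} (c : R) : \int[mu]_(x in `[0, 1]) c = c.
Proof.
by rewrite Rintegral_cst//= lebesgue_measure_itv/= lte_fin ltr01 oppr0 adde0 mulr1.
Qed.

Definition variance01 {R : realType} (f : R -> R) : R :=
  \int[mu]_(s in `[0, 1]) f s ^+ 2 - (\int[mu]_(s in `[0, 1]) f s) ^+ 2.

(** Bias-variance decomposition: the mean as centre gives the variance, any other centre an upper
    bound for it. *)
Lemma Rintegral01_sqrB {R : realType} (f : R -> R) (c : R) : continuous f ->
  \int[mu]_(s in `[0, 1]) (f s - c) ^+ 2 =
  variance01 f + (\int[mu]_(s in `[0, 1]) f s - c) ^+ 2.
Proof.
move=> cf.
have cf2 : continuous (fun s => f s ^+ 2) by move=> s; apply: continuous_pow; exact: cf.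
transitivity (\int[mu]_(s in `[0, 1])
    (1 * (1 * f s ^+ 2 + (- (2 * c)) * f s) + c ^+ 2 * 1)).
  by apply: eq_Rintegral => s _; ring.
rewrite (Rintegral_itv_lin (fun s => 1 * f s ^+ 2 + (- (2 * c)) * f s) (fun=> 1)).
- by rewrite Rintegral_itv_lin// Rintegral01_cst /variance01; ring.
- suff H : forall s, {for s, continuous (fun s => 1 * f s ^+ 2 + (- (2 * c)) * f s)} by [].
  by solve_cont.
- exact: cst_continuous.
Qed.

Lemma is_derive_shiftl {R : realType} (f : R -> R) (a y df : R) :
  is_derive (a + y) 1 f df -> is_derive y 1 (fun x => f (a + x)) df.
Proof.
move=> dfa.
have := is_derive_add _ _ y 1 _ _ (is_derive_cst a y 1) (is_derive_id y 1).
rewrite add0r => da.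
by have := is_derive1_comp dfa da; rewrite mulr1.
Qed.

Lemma is_derive_subl {R : realType} (f : R -> R) (a y df : R) :
  is_derive (a - y) 1 f df -> is_derive y 1 (fun x => f (a - x)) (- df).
Proof.
move=> dfa.
have := is_derive_sub _ _ y 1 _ _ (is_derive_cst a y 1) (is_derive_id y 1).
rewrite sub0r => da.
by have := @is_derive1_comp R f (fun x => a - x) y df (-1) dfa da; rewrite mulrN1.
Qed.

Lemma continuous_shiftl {R : realType} (f : R -> R) (a : R) :
  continuous f -> continuous (fun y : R => f (a + y)).
Proof.
move=> cf y; have c : {for y, continuous (fun y : R => a + y)} by solve_cont.
exact: (continuous_comp c (cf _)).
Qed.

Lemma continuous_subl {R : realType} (f : R -> R) (a : R) :
  continuous f -> continuous (fun y : R => f (a - y)).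
Proof.
move=> cf y; have c : {for y, continuous (fun y : R => a - y)} by solve_cont.
exact: (continuous_comp c (cf _)).
Qed.

(** The variance is at most the second moment about [w (1/2)], and the weight is symmetric under
    [s -> 1 - s]. Hence [half_interval_hardy] applies on each half, to [w (1/2 + y)] and to
    [w (1/2 - y)]. *)
Lemma weighted_poincare01 {R : realType} (w w' : R -> R) :
  (forall y : R, is_derive y 1 w (w' y)) -> continuous w' ->
  4000 / 729 * variance01 w <=
  \int[mu]_(s in `[0, 1]) ((1 - 9 / 10 * Num.max s (1 - s) ^+ 2) * w' s ^+ 2).
Proof.
move=> dw cw'.
have cw : continuous w by move=> y; exact: is_derive1_continuous (dw y).
pose r (s : R) : R := (1 - 9 / 10 * Num.max s (1 - s) ^+ 2) * w' s ^+ 2.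
pose q (s : R) := (w s - w 2^-1) ^+ 2.
have cr : forall s, {for s, continuous r}.
  move=> s; rewrite /r.
  have cm : {for s, continuous (fun s : R => Num.max s (1 - s))}.
    have c1 : {for s, continuous (fun s : R => 1 - s)} by solve_cont.
    exact: (@continuous_max _ _ (fun s : R => s) _ s (@cvg_id _ _) c1).
  by solve_cont.
have cq : forall s, {for s, continuous q} by rewrite /q; solve_cont.
pose G (s : R) : R := 1 * r s + (- (4000 / 729)) * q s.
have cG : forall s, {for s, continuous G} by rewrite /G; solve_cont.
suff : 0 <= \int[mu]_(s in `[0, 1]) G s.
  rewrite Rintegral_itv_lin// Rintegral01_sqrB// mul1r => H.
  have := sqr_ge0 (\int[mu]_(s in `[0, 1]) w s - w 2^-1).
  by rewrite -/(\int[mu]_(s in `[0, 1]) r s); lra.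
(* One primitive [H] of [G] replaces the substitutions [s = 1/2 + y] and [s = 1/2 - y]: each half
   becomes a difference of values of [H]. *)
have [H dH] := @antiderivative_exists R G (-1) cG.
have h0 : (0 : R) <= 2^-1 by rewrite invr_ge0.
have dH01 (x : R) : 0 <= x <= 1 -> is_derive x 1 H (G x).
  by move=> /andP[x0 _]; apply: dH; apply: lt_le_trans x0; rewrite ltrN10.
rewrite (Rintegral_FTC2 _ _ _ _ ler01 (fun x _ => cG x) dH01).
have R1 : 0 <= H 1 - H 2^-1.
  have d1 (y : R) : is_derive y 1 (fun y => w (2^-1 + y)) (w' (2^-1 + y)).
    exact: is_derive_shiftl.
  have c1 : continuous (fun y : R => w' (2^-1 + y)).
    exact: continuous_shiftl.
  have := half_interval_hardy _ _ d1 c1.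
  rewrite (_ : \int[mu]_(y in _) _ = \int[mu]_(y in `[0, 2^-1]) G (2^-1 + y)); last first.
    apply: eq_Rintegral => y; rewrite inE/= in_itv/= => /andP[y0 y1].
    by rewrite /G /r /q addr0 max_l; [ring|lra].
  have dG (y : R) : 0 <= y <= 2^-1 ->
      is_derive y 1 (fun y => H (2^-1 + y)) (G (2^-1 + y)).
    by move=> /andP[y0 y1]; apply: is_derive_shiftl; apply: dH; lra.
  have cGy (y : R) : 0 <= y <= 2^-1 -> {for y, continuous (fun y : R => G (2^-1 + y))}.
    by move=> _; exact: continuous_shiftl.
  rewrite (Rintegral_FTC2 _ _ _ _ h0 cGy dG).
  by rewrite addr0 -[X in X + X]mul1r -splitr.
have R2 : 0 <= H 2^-1 - H 0.
  have d1 (y : R) : is_derive y 1 (fun y => w (2^-1 - y)) (- w' (2^-1 - y)).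
    exact: is_derive_subl.
  have c1 : continuous (fun y : R => - w' (2^-1 - y)).
    by move=> y; apply: continuousN; exact: continuous_subl.
  have := half_interval_hardy _ _ d1 c1.
  (* The double negation is the form in which the derivative of [- H (1/2 - y)] arises. *)
  rewrite (_ : \int[mu]_(y in _) _ =
      \int[mu]_(y in `[0, 2^-1]) - - G (2^-1 - y)); last first.
    apply: eq_Rintegral => y; rewrite inE/= in_itv/= => /andP[y0 y1].
    rewrite /G /r /q subr0 max_r; last by lra.
    have -> : 1 - (2^-1 - y) = 2^-1 + y by field.
    by ring.
  have dG (y : R) : 0 <= y <= 2^-1 ->
      is_derive y 1 (fun y => - H (2^-1 - y)) (- - G (2^-1 - y)).
    move=> /andP[y0 y1]; have dy : is_derive (2^-1 - y) 1 H (G (2^-1 - y)).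
      by apply: dH; lra.
    exact: (is_deriveN (is_derive_subl _ _ _ _ dy)).
  have cGy (y : R) : 0 <= y <= 2^-1 -> {for y, continuous (fun y : R => - - G (2^-1 - y))}.
    by move=> _; do 2 apply: continuousN; exact: continuous_subl.
  rewrite (Rintegral_FTC2 _ _ _ _ h0 cGy dG).
  by rewrite subr0 subrr opprK addrC.
by lra.
Qed.

(** * Variance along slices parallel to the edge *)

(** The covariance is the integral of [(v - m) d]. Young's inequality bounds twice its integrand by
    [81/200 r d^2 + 200/81 / r (v - m)^2], where [81/200 = 9/20 * 9/10]. The Poincare inequality for
    [v' = r eps] controls the last term, and [200/81 * 729/4000 = 9/20] explains the constant
    [4000/729]. *)
Lemma slice_covariance_le {R : realType} (v eps d : R -> R) (r : R) : 0 < r ->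
  (forall s : R, is_derive s 1 v (r * eps s)) -> continuous eps -> continuous d ->
  2 * (\int[mu]_(s in `[0, 1]) (v s * d s)
       - \int[mu]_(s in `[0, 1]) v s * \int[mu]_(s in `[0, 1]) d s) <=
  9 / 20 * r * \int[mu]_(s in `[0, 1])
    (9 / 10 * d s ^+ 2 + (1 - 9 / 10 * Num.max s (1 - s) ^+ 2) * eps s ^+ 2).
Proof.
move=> r0 dv ce cd.
have cv : continuous v by move=> s; exact: is_derive1_continuous (dv s).
pose m := \int[mu]_(s in `[0, 1]) v s.
pose w s := (1 - 9 / 10 * Num.max s (1 - s) ^+ 2) * eps s ^+ 2.
have cw : forall s, {for s, continuous w}.
  move=> s; rewrite /w.
  have cm : {for s, continuous (fun s : R => Num.max s (1 - s))}.
    have c1 : {for s, continuous (fun s : R => 1 - s)} by solve_cont.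
    exact: (@continuous_max _ _ (fun s : R => s) _ s (@cvg_id _ _) c1).
  by solve_cont.
have cd2 : forall s, {for s, continuous (fun s => d s ^+ 2)} by solve_cont.
have cvd : forall s, {for s, continuous (fun s => v s * d s)} by solve_cont.
have cvm : forall s, {for s, continuous (fun s => (v s - m) ^+ 2)} by solve_cont.
have P : 4000 / 729 * variance01 v <= r ^+ 2 * \int[mu]_(s in `[0, 1]) w s.
  have cre : continuous (fun s => r * eps s).
    suff H : forall s, {for s, continuous (fun s => r * eps s)} by [].
    by solve_cont.
  have := weighted_poincare01 _ _ dv cre.
  (* The null term [0 * w s] gives the integrand the shape of [Rintegral_itv_lin]. *)
  rewrite (_ : \int[mu]_(s in _) _ =
      \int[mu]_(s in `[0, 1]) (r ^+ 2 * w s + 0 * w s)); last first.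
    by apply: eq_Rintegral => s _; rewrite /w; ring.
  by rewrite Rintegral_itv_lin// mul0r addr0.
have V : \int[mu]_(s in `[0, 1]) (v s - m) ^+ 2 = variance01 v.
  by rewrite Rintegral01_sqrB// subrr expr0n addr0.
(* Young's inequality with the parameter that makes both sides balance *)
have Y : \int[mu]_(s in `[0, 1]) (2 * (v s * d s) + (- (2 * m)) * d s) <=
    \int[mu]_(s in `[0, 1])
      ((9 / 20 * r * (9 / 10)) * d s ^+ 2 + (200 / 81 / r) * (v s - m) ^+ 2).
  apply: le_Rintegral_continuous => s _; [by solve_cont|by solve_cont|].
  rewrite -subr_ge0.
  have -> : 9 / 20 * r * (9 / 10) * d s ^+ 2 + 200 / 81 / r * (v s - m) ^+ 2 -
      (2 * (v s * d s) + - (2 * m) * d s) =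
      200 / 81 / r * (v s - m - 81 / 200 * r * d s) ^+ 2.
    by field; rewrite gt_eqF.
  by rewrite mulr_ge0 ?sqr_ge0// divr_ge0// ltW.
move: Y; rewrite !Rintegral_itv_lin// V => Y.
rewrite (_ : \int[mu]_(s in _) (_ + _) =
    \int[mu]_(s in `[0, 1]) (9 / 10 * d s ^+ 2 + 1 * w s)); last first.
  by apply: eq_Rintegral => s _; rewrite mul1r.
rewrite Rintegral_itv_lin//.
have Q : 200 / 81 / r * variance01 v <= 9 / 20 * r * \int[mu]_(s in `[0, 1]) w s.
  have -> : 200 / 81 / r * variance01 v =
      9 / 20 / r * (4000 / 729 * variance01 v) by field; rewrite gt_eqF.
  have -> : 9 / 20 * r * \int[mu]_(s in `[0, 1]) w s =
     9 / 20 / r * (r ^+ 2 * \int[mu]_(s in `[0, 1]) w s) by field; rewrite gt_eqF.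
  by rewrite ler_wpM2l// divr_ge0// ltW.
by move: Y Q; rewrite -/m; lra.
Qed.

(** In the application [x = (P2 - P3).g], [y = (P3 - P1).g] and [t = h^2 |g|^2]. With 1 in place of
    9/10 the left side is a convex combination of [x^2 + x y + y^2] and of [y^2] or [x^2], according
    to the half that contains [s]. Nine tenths of that bound and one tenth of [(x + y)^2 <= t] add
    up to the claim. *)
Lemma hexagon_bound {R : realType} (x y t s : R) : 0 <= s <= 1 ->
  x ^+ 2 <= t -> y ^+ 2 <= t -> (x + y) ^+ 2 <= t ->
  9 / 10 * (s * x - (1 - s) * y) ^+ 2
    + (1 - 9 / 10 * Num.max s (1 - s) ^+ 2) * (x + y) ^+ 2 <= t.
Proof.
move=> /andP[s0 s1] xt yt xyt.
(* the quadratic form through the six vertices of the hexagon |x|, |y|, |x + y| <= 1 *)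
have Q : x ^+ 2 + x * y + y ^+ 2 <= t.
  have [xy|/ltW xy] := lerP 0 (x * y); first by move: xyt; nra.
  have [h|/ltW h] := lerP 0 (x * (x + y)).
    by have [h2|/ltW h2] := lerP 0 (y * (x + y)); move: xt yt xyt; nra.
  by move: xt yt xyt; nra.
suff H : (s * x - (1 - s) * y) ^+ 2 + (1 - Num.max s (1 - s) ^+ 2) * (x + y) ^+ 2 <= t.
  by move: H xyt; lra.
have [h|/ltW h] := lerP s (1 - s).
  have -> : (s * x - (1 - s) * y) ^+ 2 + (1 - (1 - s) ^+ 2) * (x + y) ^+ 2 =
     (1 - 2 * s) * y ^+ 2 + 2 * s * (x ^+ 2 + x * y + y ^+ 2) by ring.
  have -> : t = (1 - 2 * s) * t + 2 * s * t by ring.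
  by apply: lerD; rewrite ler_wpM2l//; lra.
have -> : (s * x - (1 - s) * y) ^+ 2 + (1 - s ^+ 2) * (x + y) ^+ 2 =
     (2 * s - 1) * x ^+ 2 + (2 - 2 * s) * (x ^+ 2 + x * y + y ^+ 2) by ring.
have -> : t = (2 * s - 1) * t + (2 - 2 * s) * t by ring.
by apply: lerD; rewrite ler_wpM2l//; lra.
Qed.

(** * Continuity and differentiation under the integral sign *)

Section under_integral.
Context {R : realType}.

Lemma continuous_bounded_rectangle (F : R * R -> R) (a b c d : R) :
  continuous F -> exists M, forall x y, a <= x <= b -> c <= y <= d ->
    `|F (x, y)| <= M.
Proof.
move=> cF.
have cK : compact (`[a, b]%classic `*` `[c, d]%classic : set (R * R)).
  by apply: compact_setX; exact: segment_compact.
have /compact_bounded[M [_ HM]] := continuous_compact (continuous_subspaceT cF) cK.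
exists (M + 1) => x y xab ycd; apply: (HM (M + 1)); first by rewrite ltrDl.
by exists (x, y) => //; split => /=; rewrite in_itv.
Qed.

Lemma continuous_section (F : R * R -> R) (r : R) :
  continuous F -> continuous (fun s => F (r, s)).
Proof.
move=> cF s.
have c : {for s, continuous (fun s : R => (r, s))} by solve_cont.
exact: (continuous_comp c (cF _)).
Qed.

Lemma continuous_Rintegral01 (F : R * R -> R) : continuous F ->
  continuous (fun r => \int[mu]_(s in `[0, 1]) F (r, s)).
Proof.
move=> cF r.
have [M HM] := continuous_bounded_rectangle F (r - 1) (r + 1) 0 1 cF.
have := @continuity_under_integral R _ _ mu (fun r s => F (r, s)) `[0, 1].
move=> /(_ _ (r - 1) (r + 1) _ _ (fun=> M)); apply => //=.
- move=> x _; apply: continuous_itv_integrable => s _; exact: continuous_section.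
- apply: aeW => /= s _ x _.
  have c : {for x, continuous (fun x : R => (x, s))} by solve_cont.
  exact: (continuous_comp c (cF _)).
- by apply: continuous_itv_integrable => s _; exact: cvg_cst.
- move=> x; rewrite in_itv/= => /andP[/ltW h1 /ltW h2].
  by apply: aeW => /= s; rewrite in_itv/= => s01; apply: HM => //; rewrite h1.
- by rewrite inE/= in_itv/= ltrBlDr ltrDl ltr01.
Qed.

Lemma is_derive_Rintegral01 (F F1 : R * R -> R) : continuous F -> continuous F1 ->
  (forall r s : R, is_derive r 1 (fun r => F (r, s)) (F1 (r, s))) ->
  forall r : R, is_derive r 1 (fun r => \int[mu]_(s in `[0, 1]) F (r, s))
    (\int[mu]_(s in `[0, 1]) F1 (r, s)).
Proof.
move=> cF cF1 dF r.
have [M HM] := continuous_bounded_rectangle F1 (r - 1) (r + 1) 0 1 cF1.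
have E x y : partial1of2 (fun r s => F (r, s)) x y = F1 (x, y).
  by rewrite partial1of2E; exact: derive_val.
have := @cvg_differentiation_under_integral R _ _ mu (fun r s => F (r, s)) `[0, 1].
(* The dominating function is a bound of [F1] on a compact rectangle around [r]; the absolute value
   makes it nonnegative. *)
move=> /(_ _ r (r - 1) (r + 1) _ _ _ (fun=> `|M|)) H.
have {}H : h^-1 *: (\int[mu]_(s in `[0, 1]) F (h + r, s) -
    \int[mu]_(s in `[0, 1]) F (r, s)) @[h --> 0^'] -->
    \int[mu]_(s in `[0, 1]) F1 (r, s).
  rewrite (_ : \int[mu]_(s in `[0, 1]) F1 (r, s) =
    \int[mu]_(s in `[0, 1]) partial1of2 (fun r s => F (r, s)) r s); last first.
    by apply: eq_Rintegral => s _; rewrite E.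
  apply: H => //=.
  - by rewrite in_itv/= ltrBlDr ltrDl ltr01.
  - by move=> x _; apply: continuous_itv_integrable => s _; exact: continuous_section.
  - by apply: continuous_itv_integrable => s _; exact: cvg_cst.
  - move=> x y; rewrite !in_itv/= => /andP[/ltW h1 /ltW h2] y01.
    by rewrite E; apply: le_trans (ler_norm M); apply: HM => //; rewrite h1.
apply: DeriveDef.
  apply/cvg_ex => /=; exists (\int[mu]_(s in `[0, 1]) F1 (r, s)).
  by under eq_fun do rewrite scaler1.
rewrite -derive1E /derive1.
by apply/cvg_lim => //.
Qed.
End under_integral.

Lemma is_derive_line {R : realType} (f : @pt R -> R) (p v : @pt R) (r l : R) :
  is_derive (p + r *: v) v f l -> is_derive r 1 (fun r => f (p + r *: v)) l.
Proof.
have E : (fun h : R => h^-1 *: (f (p + (h *: 1 + r) *: v) - f (p + r *: v))) =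
    (fun h : R => h^-1 *: (f (h *: v + (p + r *: v)) - f (p + r *: v))).
  apply/funext => h; congr (_ *: (f _ - _)).
  by rewrite [h *: 1]mulr1 scalerDl addrCA.
move=> [dfl El]; apply: DeriveDef; last first.
  by rewrite -El /derive/= E.
by rewrite /derivable/= E.
Qed.

Lemma cauchy_schwarz2 {R : realType} (a b x y : R) :
  (a * x + b * y) ^+ 2 <= (a ^+ 2 + b ^+ 2) * (x ^+ 2 + y ^+ 2).
Proof.
rewrite -subr_ge0.
have -> : (a ^+ 2 + b ^+ 2) * (x ^+ 2 + y ^+ 2) - (a * x + b * y) ^+ 2 =
  (a * y - b * x) ^+ 2 by ring.
exact: sqr_ge0.
Qed.

(* (r, s) runs over the rays from the apex P3 to the edge P1P2 *)
Definition cone {R : realType} (P1 P2 P3 : @pt R) (z : R * R) : @pt R :=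
  (P3.1 + z.1 * (P1.1 - P3.1 + z.2 * (P2.1 - P1.1)),
   P3.2 + z.1 * (P1.2 - P3.2 + z.2 * (P2.2 - P1.2))).

Lemma continuous_cone {R : realType} (P1 P2 P3 : @pt R) :
  forall z, {for z, continuous (cone P1 P2 P3)}.
Proof. by rewrite /cone; solve_cont. Qed.

(** * The variance bound for differentiable functions *)

Section smooth_estimate.
Context {R : realType} (P1 P2 P3 : @pt R) (f fx fy : @pt R -> R).
Hypothesis cf : continuous f.
Hypothesis cfx : continuous fx.
Hypothesis cfy : continuous fy.
Hypothesis df : forall x v : @pt R, is_derive x v f (v.1 * fx x + v.2 * fy x).

Let T := cone P1 P2 P3.
Let W z := f (T z).
Let d (z : R * R) := (P1.1 - P3.1 + z.2 * (P2.1 - P1.1)) * fx (T z)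
  + (P1.2 - P3.2 + z.2 * (P2.2 - P1.2)) * fy (T z).
Let eps z := (P2.1 - P1.1) * fx (T z) + (P2.2 - P1.2) * fy (T z).
Let q z := fx (T z) ^+ 2 + fy (T z) ^+ 2.

Let continuous_comp_cone (g : @pt R -> R) : continuous g ->
  forall z, {for z, continuous (fun z => g (T z))}.
Proof. by move=> cg z; apply: (continuous_comp (continuous_cone P1 P2 P3 z)); exact: cg. Qed.

Let cW := continuous_comp_cone _ cf.
Let cX := continuous_comp_cone _ cfx.
Let cY := continuous_comp_cone _ cfy.

Let cd : forall z, {for z, continuous d}.
Proof. by rewrite /d; solve_cont. Qed.

Let ceps : forall z, {for z, continuous eps}.
Proof. by rewrite /eps; solve_cont. Qed.

Let cq : forall z, {for z, continuous q}.
Proof. by rewrite /q; solve_cont. Qed.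

Let dWr (r s : R) : is_derive r 1 (fun r => W (r, s)) (d (r, s)).
Proof.
pose v : @pt R := (P1.1 - P3.1 + s * (P2.1 - P1.1), P1.2 - P3.2 + s * (P2.2 - P1.2)).
exact: (is_derive_line f P3 v r _ (df _ v)).
Qed.

(** The slice at [r] is the edge shrunk by [r], whence the factor in front of [eps]. *)
Let dWs (r s : R) : is_derive s 1 (fun s => W (r, s)) (r * eps (r, s)).
Proof.
pose v : @pt R := (r * (P2.1 - P1.1), r * (P2.2 - P1.2)).
pose p : @pt R := (P3.1 + r * (P1.1 - P3.1), P3.2 + r * (P1.2 - P3.2)).
have E (t : R) : p + t *: v = T (r, t).
  by congr (_, _) => /=; rewrite /GRing.scale/=; ring.
have := is_derive_line f p v s _ (df _ v).
rewrite (_ : (fun t : R => f (p + t *: v)) = (fun t => W (r, t))); last first.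
  by apply/funext => t; rewrite E.
move=> H; apply: (is_derive_eq H).
by rewrite E /eps /v /=; ring.
Qed.

(** The function [9/20 h2 A - V] is nondecreasing on [0, 1], where [A] is a primitive of the
    right-hand integrand. At [r = 0] the slice collapses to [P3], and at [r = 1] it is the edge. The
    factor [r] is the Jacobian of the cone coordinates up to the determinant. *)
Lemma trace_variance_le (h2 : R) :
  (P2.1 - P1.1) ^+ 2 + (P2.2 - P1.2) ^+ 2 <= h2 ->
  (P3.1 - P2.1) ^+ 2 + (P3.2 - P2.2) ^+ 2 <= h2 ->
  (P1.1 - P3.1) ^+ 2 + (P1.2 - P3.2) ^+ 2 <= h2 ->
  variance01 (fun s => f (seg P1 P2 s)) <=
  9 / 20 * h2 * \int[mu]_(r in `[0, 1]) (r * \int[mu]_(s in `[0, 1]) q (r, s)).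
Proof.
move=> h12 h23 h31.
pose V r := variance01 (fun s => W (r, s)).
(* Twice the covariance of [W] and [d] on the slice, found by differentiating both integrals of the
   variance. *)
pose V' r := \int[mu]_(s in `[0, 1]) (2 * (W (r, s) * d (r, s)))
  - 2 * (\int[mu]_(s in `[0, 1]) W (r, s) * \int[mu]_(s in `[0, 1]) d (r, s)).
have dV (r : R) : is_derive r 1 V (V' r).
  have cW2 : forall z, {for z, continuous (fun z => W z ^+ 2)} by rewrite /W; solve_cont.
  have cWd : forall z, {for z, continuous (fun z => 2 * (W z * d z))} by rewrite /W; solve_cont.
  have dW2 (x s : R) : is_derive x 1 (fun r => W (r, s) ^+ 2) (2 * (W (x, s) * d (x, s))).
    apply: (is_derive_eq (is_derive_exp _ 1 _ _ _ (dWr x s))).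
    by rewrite expr1 mulrA.
  have H1 := is_derive_Rintegral01 _ _ cW2 cWd dW2 r.
  have H2 := is_derive_Rintegral01 _ _ cW cd dWr r.
  apply: (is_derive_eq (is_derive_sub _ _ _ _ _ _ H1 (is_derive_exp _ 1 _ _ _ H2))).
  by rewrite expr1 /V' mulrA.
have -> : variance01 (fun s => f (seg P1 P2 s)) = V 1.
  rewrite /V; congr variance01; apply/funext => s; congr f.
  by rewrite /seg /T /cone /=; congr (_, _); ring.
have V0 : V 0 = 0.
  rewrite /V (_ : (fun s => W (0, s)) = cst (f P3)); last first.
    apply/funext => s; congr f; rewrite /T /cone/= !mul0r !addr0.
    by case: P3.
  by rewrite /variance01 (Rintegral01_cst (f P3 ^+ 2)) (Rintegral01_cst (f P3)) subrr.
pose e r := r * \int[mu]_(s in `[0, 1]) q (r, s).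
have ce : forall r, {for r, continuous e}.
  move=> r; rewrite /e; apply: continuousM; first exact: cvg_id.
  exact: continuous_Rintegral01.
have [A dA] := @antiderivative_exists R e (-1) ce.
have dA01 (r : R) : 0 <= r <= 1 -> is_derive r 1 A (e r).
  by move=> /andP[r0 _]; apply: dA; apply: lt_le_trans r0; rewrite ltrN10.
rewrite (Rintegral_FTC2 _ _ _ _ ler01 (fun x _ => ce x) dA01).
pose G r := 9 / 20 * h2 * A r - V r.
pose g r := 9 / 20 * h2 * e r - V' r.
have dG (r : R) : 0 <= r <= 1 -> is_derive r 1 G (g r).
  move=> r01; exact: (is_derive_sub _ _ _ _ _ _
    (is_derive_scale (9 / 20 * h2) _ _ _ _ (dA01 r r01)) (dV r)).
have : G 0 <= G 1.
  apply: (@derive_ge0_le _ G g 0 1 ler01 dG) => r /andP[r0 r1].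
  have cer : continuous (fun s => eps (r, s)) by exact: continuous_section.
  have cdr : continuous (fun s => d (r, s)) by exact: continuous_section.
  have cWr : continuous (fun s => W (r, s)) by exact: continuous_section.
  have cqr : continuous (fun s => q (r, s)) by exact: continuous_section.
  have cWdr : forall s, {for s, continuous (fun s => W (r, s) * d (r, s))}.
    by solve_cont.
  have S := slice_covariance_le _ _ _ r r0 (dWs r) cer cdr.
  have V'E : V' r = 2 * (\int[mu]_(s in `[0, 1]) (W (r, s) * d (r, s))
       - \int[mu]_(s in `[0, 1]) W (r, s) * \int[mu]_(s in `[0, 1]) d (r, s)).
    rewrite /V' mulrBr; congr (_ - _).
    transitivity (\int[mu]_(s in `[0, 1])
       (2 * (W (r, s) * d (r, s)) + 0 * (W (r, s) * d (r, s)))).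
      by apply: eq_Rintegral => s _; rewrite mul0r addr0.
    by rewrite Rintegral_itv_lin// mul0r addr0.
  rewrite /g subr_ge0 V'E; apply: (le_trans S).
  have -> : 9 / 20 * h2 * e r =
      9 / 20 * r * \int[mu]_(s in `[0, 1]) (h2 * q (r, s) + 0 * q (r, s)).
    by rewrite Rintegral_itv_lin// /e; ring.
  apply: ler_wpM2l; first by rewrite mulr_ge0// ltW.
  pose lhs s := 9 / 10 * d (r, s) ^+ 2 +
    (1 - 9 / 10 * Num.max s (1 - s) ^+ 2) * eps (r, s) ^+ 2.
  pose rhs s := h2 * q (r, s) + 0 * q (r, s).
  apply: (@le_Rintegral_continuous R lhs rhs 0 1) => s; rewrite /lhs /rhs.
  - move=> _.
    have cm : {for s, continuous (fun s : R => Num.max s (1 - s))}.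
      have c1 : {for s, continuous (fun s : R => 1 - s)} by solve_cont.
      exact: (@continuous_max _ _ (fun s : R => s) _ s (@cvg_id _ _) c1).
    by solve_cont.
  - by move=> _; solve_cont.
  - move=> s01; rewrite mul0r addr0.
    pose X := fx (T (r, s)); pose Y := fy (T (r, s)).
    have q0 : 0 <= X ^+ 2 + Y ^+ 2 by rewrite addr_ge0// sqr_ge0.
    have CS a b : a ^+ 2 + b ^+ 2 <= h2 -> (a * X + b * Y) ^+ 2 <= h2 * q (r, s).
      by move=> ab; apply: le_trans (cauchy_schwarz2 _ _ _ _) _; rewrite ler_wpM2r.
    (* The two arguments and their sum [eps] are the derivatives along the edge vectors, so
       Cauchy-Schwarz bounds their squares by [h2 q]. *)
    have := hexagon_bound ((P2.1 - P3.1) * X + (P2.2 - P3.2) * Y)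
      ((P3.1 - P1.1) * X + (P3.2 - P1.2) * Y) (h2 * q (r, s)) s s01.
    have -> : (P2.1 - P3.1) * X + (P2.2 - P3.2) * Y +
      ((P3.1 - P1.1) * X + (P3.2 - P1.2) * Y) = eps (r, s).
      by rewrite /eps -/X -/Y; ring.
    have -> : s * ((P2.1 - P3.1) * X + (P2.2 - P3.2) * Y) -
      (1 - s) * ((P3.1 - P1.1) * X + (P3.2 - P1.2) * Y) = d (r, s).
      by rewrite /d/= -/X -/Y; ring.
    apply; apply: CS => //.
    + by move: h23; rewrite -(sqrrN (P3.1 - _)) -(sqrrN (P3.2 - _)) !opprB.
    + by move: h31; rewrite -(sqrrN (P1.1 - _)) -(sqrrN (P1.2 - _)) !opprB.
by rewrite /G V0; lra.
Qed.
End smooth_estimate.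

(** * Change of variables on the triangle *)

(** An open set is the union of the countably many boxes with rational centre and radius [1/(n+1)]
    that it contains. This links the topology of the plane with the product sigma-algebra. *)
Lemma open_measurable_prod {R : realType} (U : set (R * R)) : open U ->
  measurable (U : set (measurableTypeR R * measurableTypeR R)).
Proof.
move=> oU.
pose box (p q : rat) (n : nat) : set (R * R) :=
  ball (ratr p : R) (n.+1%:R^-1 : R) `*` ball (ratr q : R) (n.+1%:R^-1 : R).
pose B p q n := if `[< box p q n `<=` U >] then box p q n else set0.
have -> : U = \bigcup_(p in [set: rat]) \bigcup_(q in [set: rat])
    \bigcup_(n in [set: nat]) B p q n.
  apply/seteqP; split => [[x y] Uxy|xy [p _ [q _ [n _]]]]; last first.
    by rewrite /B; case: asboolP => // sub; exact: sub.
  have [e /= e0 He] : exists2 e : R, 0 < e & ball (x, y) e `<=` U.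
    by move: oU; rewrite openE => /(_ _ Uxy) /nbhs_ballP[e e0 He]; exists e.
  (* With a radius below [e / 2], a box whose centre is within one radius of [(x, y)] in each
     coordinate stays inside the [e]-ball. *)
  have [n ne] : exists n : nat, n.+1%:R^-1 < e / 2.
    have e2 : 0 < e / 2 by rewrite divr_gt0.
    have [n _ /(_ n (leqnn n)) ne] := near_infty_natSinv_lt (PosNum e2).
    by exists n.
  have n0 : (0 : R) < n.+1%:R^-1 by rewrite invr_gt0.
  have rat_near (z : R) : exists p : rat, `|ratr p - z| < n.+1%:R^-1.
    have /rat_in_itvoo[p] : z - n.+1%:R^-1 < z + n.+1%:R^-1.
      by rewrite ltrBlDr -addrA ltrDl addr_gt0.
    by rewrite in_itv/= => pz; exists p; rewrite ltr_distl.
  have [p px] := rat_near x; have [q qy] := rat_near y.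
  exists p => //; exists q => //; exists n => //; rewrite /B ifT.
    by split => /=; rewrite -ball_normE.
  apply/asboolP => -[x' y'] [/=]; rewrite -!ball_normE/= => px' qy'.
  apply: He; split; rewrite -ball_normE/=.
    have -> : x - x' = (x - ratr p) + (ratr p - x') by ring.
    by rewrite (le_lt_trans (ler_normD _ _))// [ltRHS]splitr ltrD// (lt_trans _ ne)// distrC.
  have -> : y - y' = (y - ratr q) + (ratr q - y') by ring.
  by rewrite (le_lt_trans (ler_normD _ _))// [ltRHS]splitr ltrD// (lt_trans _ ne)// distrC.
apply: bigcupT_measurable_rat => p; apply: bigcupT_measurable_rat => q.
apply: bigcupT_measurable => n; rewrite /B; case: asboolP => // _.
by apply: measurableX; rewrite ball_itv; exact: measurable_itv.
Qed.

Lemma continuous_measurable_prod {R : realType} (f : R * R -> R) : continuous f ->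
  measurable_fun setT (f : measurableTypeR R * measurableTypeR R -> R).
Proof.
move=> /continuousP cf; apply: (measurability _ (measurable_realfun.RGenOInfty.measurableE R)).
move=> _ [_ [a ->] <-]; rewrite setTI; apply: open_measurable_prod.
exact/cf/interval_open.
Qed.

Section affine_change.
Context {R : realType}.
Local Open Scope ereal_scope.

(** Both sides are measures in [A], and Lebesgue measure is determined by its values on half-open
    intervals. *)
Lemma lebesgue_measure_affine (k c : R) (A : set R) : (k != 0)%R -> measurable A ->
  `|k|%:E * lebesgue_measure ((fun x : R => k * x + c)%R @^-1` A) = lebesgue_measure A.
Proof.
move=> k0 mA.
pose phi := (fun x : R => k * x + c)%R : measurableTypeR R -> measurableTypeR R.
have mphi : measurable_fun setT phi.
  by apply: measurable_funD => //; apply: measurable_funM.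
apply: esym.
apply: (@lebesgue_measure_unique R
  (mscale (`|k|%:nng)%R (pushforward lebesgue_measure phi))) => //= _ [[a b]] _ <-.
rewrite /= /mscale/= /pushforward lebesgue_measure_itv/= lte_fin.
have [kp|kn|/eqP] := ltrgtP k 0%R; last by rewrite (negbTE k0).
(* For negative [k] the orientation is reversed: the preimage is closed on the left and open on the
   right. *)
- have -> : phi @^-1` `]a, b] = `[((b - c) / k)%R, ((a - c) / k)%R[%classic.
    apply/seteqP; split => x; rewrite /phi /= !in_itv/=.
    + by move=> /andP[ax xb]; rewrite ler_ndivrMr// ltr_ndivlMr//; lra.
    + by rewrite ler_ndivrMr// ltr_ndivlMr//; lra.
  rewrite lebesgue_measure_itv/= lte_fin ltr_ndivrMr// divfK//.
  rewrite ltrD2r; case: ifPn => _; last by rewrite mule0.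
  rewrite -EFinB -EFinM; congr EFin; rewrite ltr0_norm//.
  by field.
- have -> : phi @^-1` `]a, b] = `]((a - c) / k)%R, ((b - c) / k)%R]%classic.
    apply/seteqP; split => x; rewrite /phi /= !in_itv/=.
    + by move=> /andP[ax xb]; rewrite ler_pdivlMr// ltr_pdivrMr//; lra.
    + by rewrite ler_pdivlMr// ltr_pdivrMr//; lra.
  rewrite lebesgue_measure_itv/= lte_fin ltr_pdivrMr// divfK//.
  rewrite ltrD2r; case: ifPn => _; last by rewrite mule0.
  rewrite -EFinB -EFinM; congr EFin; rewrite gtr0_norm//.
  by field.
Qed.

Lemma ge0_integral_affine (k c : R) (g : R -> \bar R) : (k != 0)%R ->
  measurable_fun setT g -> (forall x, 0 <= g x) ->
  `|k|%:E * \int[lebesgue_measure]_x g (k * x + c)%R = \int[lebesgue_measure]_x g x.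
Proof.
move=> k0 mg g0.
have mphi : measurable_fun setT ((fun x : R => k * x + c)%R : measurableTypeR R -> measurableTypeR R).
  by apply: measurable_funD => //; apply: measurable_funM.
have := @ge0_integral_pushforward _ _ _ _ R _ mphi lebesgue_measure setT g.
rewrite preimage_setT => <- //.
rewrite -(@ge0_integral_mscale _ _ _ _ setT _ (`|k|%:nng)%R)//=.
apply: eq_measure_integral => A mA _ /=.
exact: lebesgue_measure_affine.
Qed.
End affine_change.

Section affine_change2.
Context {R : realType}.
Local Open Scope ereal_scope.

Lemma measurable_affine2 (a b c d e1 e2 : R) :
  measurable_fun setT ((fun z : R * R => (a * z.1 + b * z.2 + e1, c * z.1 + d * z.2 + e2)%R)
    : measurableTypeR R * measurableTypeR R -> measurableTypeR R * measurableTypeR R).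
Proof.
have m (x y z : R) : measurable_fun setT ((fun t : R * R => x * t.1 + y * t.2 + z)%R
    : measurableTypeR R * measurableTypeR R -> measurableTypeR R).
  apply: continuous_measurable_prod.
  suff : forall u, {for u, continuous (fun t : R * R => x * t.1 + y * t.2 + z)%R} by [].
  by solve_cont.
by apply: measurable_fun_pair; exact: m.
Qed.

(** The inner substitution in [x] contributes [|a|] and leaves [G1], where [y] has the coefficient
    [k = det / a]. After an exchange of the integrals by Tonelli, the substitution in [y]
    contributes [|k|]. *)
Lemma ge0_iterated_affine (a b c d e1 e2 : R) (G : R * R -> \bar R) : (a != 0)%R ->
  (a * d - b * c != 0)%R ->
  measurable_fun setT (G : measurableTypeR R * measurableTypeR R -> \bar R) ->
  (forall z, 0 <= G z) ->
  `|a * d - b * c|%:E * \int[leb1]_y \int[leb1]_x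
     G (a * x + b * y + e1, c * x + d * y + e2)%R = \int[leb2]_z G z.
Proof.
move=> a0 det0 mG G0.
pose k := ((a * d - b * c) / a)%R.
have k0 : (k != 0)%R by rewrite mulf_neq0// invr_neq0.
pose G1 (z : R * R) := G (z.1, c / a * z.1 + k * z.2 + (e2 - c / a * e1))%R.
have mG1 : measurable_fun setT (G1 : measurableTypeR R * measurableTypeR R -> \bar R).
  apply: (measurableT_comp mG).
  have := measurable_affine2 1 0 (c / a) k 0 (e2 - c / a * e1).
  by under eq_fun do rewrite mul1r mul0r !addr0.
have mG1x y : measurable_fun setT ((fun x => G1 (x, y)) : measurableTypeR R -> \bar R).
  exact: measurableT_comp.
have -> : `|a * d - b * c|%R = (`|k| * `|a|)%R.
  by rewrite -normrM divfK.
rewrite EFinM -muleA.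
have E1 : `|a|%:E * \int[leb1]_y \int[leb1]_x
     G (a * x + b * y + e1, c * x + d * y + e2)%R = \int[leb1]_y \int[leb1]_x G1 (x, y).
  rewrite -ge0_integralZl//=.
  - apply: eq_integral => y _.
    rewrite -(ge0_integral_affine a (b * y + e1) (fun x => G1 (x, y)) a0 (mG1x y) (fun x => G0 _)).
    congr (_ * _); apply: eq_integral => x _; rewrite /G1 /k /=; congr (G (_, _)).
      by rewrite addrA.
    by field.
  - pose G2 (z : R * R) := G (a * z.1 + b * z.2 + e1, c * z.1 + d * z.2 + e2)%R.
    have mG2 : measurable_fun setT (G2 : measurableTypeR R * measurableTypeR R -> \bar R).
      exact: (measurableT_comp mG (measurable_affine2 a b c d e1 e2)).
    exact: (@measurable_fun_fubini_tonelli_G _ _ _ _ _ leb1 G2 mG2 (fun z => G0 _)).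
  - by move=> y _; apply: integral_ge0 => x _; exact: G0.
rewrite E1.
have <- : \int[leb1]_x \int[leb1]_y G1 (x, y) = \int[leb1]_y \int[leb1]_x G1 (x, y).
  exact: (@fubini_tonelli _ _ _ _ _ leb1 leb1 G1 mG1 (fun z => G0 _)).
rewrite -ge0_integralZl//=; last 2 first.
- exact: (@measurable_fun_fubini_tonelli_F _ _ _ _ _ leb1 G1 mG1 (fun z => G0 _)).
- by move=> x _; apply: integral_ge0 => y _; exact: G0.
rewrite /leb2 (@fubini_tonelli1 _ _ _ _ _ leb1 leb1 G)//.
apply: eq_integral => x _; rewrite /fubini_F.
have mGx : measurable_fun setT ((fun y => G (x, y)) : measurableTypeR R -> \bar R).
  exact: measurableT_comp.
rewrite -(ge0_integral_affine k (c / a * x + (e2 - c / a * e1)) (fun y => G (x, y))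
  k0 mGx (fun y => G0 _)).
congr (_ * _); apply: eq_integral => y _; rewrite /G1/=; congr (G (_, _)).
by ring.
Qed.

Lemma ge0_integral_affine2 (a b c d e1 e2 : R) (G : R * R -> \bar R) :
  (a * d - b * c != 0)%R ->
  measurable_fun setT (G : measurableTypeR R * measurableTypeR R -> \bar R) ->
  (forall z, 0 <= G z) ->
  `|a * d - b * c|%:E * \int[leb1]_x \int[leb1]_y
     G (a * x + b * y + e1, c * x + d * y + e2)%R = \int[leb2]_z G z.
Proof.
move=> det0 mG G0; have [a0|a0] := eqVneq a 0%R; last first.
  rewrite -(ge0_iterated_affine a b c d e1 e2 G a0 det0 mG G0); congr (_ * _).
  pose G2 (z : R * R) := G (a * z.1 + b * z.2 + e1, c * z.1 + d * z.2 + e2)%R.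
  have mG2 : measurable_fun setT (G2 : measurableTypeR R * measurableTypeR R -> \bar R).
    exact: (measurableT_comp mG (measurable_affine2 a b c d e1 e2)).
  exact: (@fubini_tonelli _ _ _ _ _ leb1 leb1 G2 mG2 (fun z => G0 _)).
(* For [a = 0] the variables are exchanged: [b] takes the place of [a], and the determinant only
   changes sign. *)
have b0 : (b != 0)%R.
  by apply: contraNneq det0 => b0; rewrite a0 b0 !mul0r subrr.
have det0' : (b * c - a * d != 0)%R by rewrite -oppr_eq0 opprB.
rewrite -(ge0_iterated_affine b a d c e1 e2 G b0 det0' mG G0) distrC; congr (_ * _).
apply: eq_integral => x _; apply: eq_integral => y _; congr (G (_ + _, _ + _)%R).
  by rewrite addrC.
by rewrite addrC.
Qed.
End affine_change2.

Section triangle_integral.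
Context {R : realType} (P1 P2 P3 : @pt R).
Hypothesis det0 : det3 P1 P2 P3 != 0.

(* affine coordinates in which the triangle is 0 < eta < xi < 1 *)
Let point (xi eta : R) : @pt R :=
  ((P1.1 - P3.1) * xi + (P2.1 - P1.1) * eta + P3.1,
   (P1.2 - P3.2) * xi + (P2.2 - P1.2) * eta + P3.2).

Let detE : (P1.1 - P3.1) * (P2.2 - P1.2) - (P2.1 - P1.1) * (P1.2 - P3.2) =
  det3 P1 P2 P3.
Proof. by rewrite /det3; ring. Qed.

(** The barycentric coordinates of [point xi eta] are [xi - eta], [eta] and [1 - xi]. Their
    uniqueness is Cramer's rule, so [X] and [Y] are proved after multiplication by the
    determinant. *)
Let triangle_point xi eta :
  triangle P1 P2 P3 (point xi eta) <-> (0 < eta < xi) && (xi < 1).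
Proof.
split=> [[l1 [l2 [l3 [h1 h2 h3 hs]]]]|/andP[/andP[h1 h2] h3]]; last first.
  exists (xi - eta), eta, (1 - xi); split; rewrite ?subr_gt0//; first by ring.
  by rewrite /point; congr (_, _); ring.
move=> [E1 E2].
have l3E : l3 = 1 - l1 - l2 by rewrite -hs; ring.
have X : xi = l1 + l2.
  apply/eqP; rewrite -subr_eq0; apply/eqP/(mulfI det0); rewrite mulr0 /det3.
  transitivity (((P1.1 - P3.1) * xi + (P2.1 - P1.1) * eta + P3.1
      - (l1 * P1.1 + l2 * P2.1 + l3 * P3.1)) * (P2.2 - P1.2)
    - ((P1.2 - P3.2) * xi + (P2.2 - P1.2) * eta + P3.2
      - (l1 * P1.2 + l2 * P2.2 + l3 * P3.2)) * (P2.1 - P1.1)).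
    by rewrite l3E; ring.
  by rewrite E1 E2 !subrr !mul0r subrr.
have Y : eta = l2.
  apply/eqP; rewrite -subr_eq0; apply/eqP/(mulfI det0); rewrite mulr0 /det3.
  transitivity (((P1.2 - P3.2) * xi + (P2.2 - P1.2) * eta + P3.2
      - (l1 * P1.2 + l2 * P2.2 + l3 * P3.2)) * (P1.1 - P3.1)
    - ((P1.1 - P3.1) * xi + (P2.1 - P1.1) * eta + P3.1
      - (l1 * P1.1 + l2 * P2.1 + l3 * P3.1)) * (P1.2 - P3.2)).
    by rewrite l3E; ring.
  by rewrite E1 E2 !subrr !mul0r subrr.
by rewrite X Y; lra.
Qed.

(** Cramer's rule makes [xi] and [eta] affine functions of the point, and the triangle is an
    intersection of three open half-planes. *)
Lemma measurable_triangle :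
  measurable (triangle P1 P2 P3 : set (measurableTypeR R * measurableTypeR R)).
Proof.
pose xi (x : @pt R) := (((P2.2 - P1.2) * x.1 + (- (P2.1 - P1.1)) * x.2)
  - ((P2.2 - P1.2) * P3.1 - (P2.1 - P1.1) * P3.2)) / det3 P1 P2 P3.
pose eta (x : @pt R) := (((- (P1.2 - P3.2)) * x.1 + (P1.1 - P3.1) * x.2)
  - ((P1.1 - P3.1) * P3.2 - (P1.2 - P3.2) * P3.1)) / det3 P1 P2 P3.
have E x : x = point (xi x) (eta x).
  have d0 := det0; rewrite /det3 in d0.
  rewrite /point /xi /eta /det3 [x in LHS]surjective_pairing.
  by congr (_, _); field.
have cxi : forall x, {for x, continuous xi} by rewrite /xi; solve_cont.
have ceta : forall x, {for x, continuous eta} by rewrite /eta; solve_cont.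
have -> : triangle P1 P2 P3 = (eta @^-1` `]0, +oo[) `&`
    ((fun x => xi x - eta x) @^-1` `]0, +oo[) `&` (xi @^-1` `]-oo, 1[).
  apply/seteqP; split => x.
    rewrite {1}(E x) => /triangle_point /andP[/andP[h1 h2] h3].
    by split; [split|]; rewrite /= in_itv/= ?andbT ?subr_gt0.
  move=> [[/=]]; rewrite !in_itv/= !andbT subr_gt0 => h1 h2 h3.
  by rewrite (E x); apply/triangle_point; rewrite h1 h2.
have m (g : R * R -> R) (A : set R) : (forall x, {for x, continuous g}) ->
    measurable A -> measurable (g @^-1` A : set (measurableTypeR R * measurableTypeR R)).
  move=> cg mA; rewrite -[X in measurable X]setTI.
  exact: (continuous_measurable_prod g cg).
apply: measurableI; first apply: measurableI; apply: m => //.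
by solve_cont.
Qed.

(** The affine map [point] has Jacobian [|det|]. For fixed [xi = r] the substitution [eta = r s]
    contributes [r] and leads to the cone coordinates. For [r] outside ]0, 1[ the section of the
    triangle is empty. *)
Lemma integral_triangle (q : @pt R -> R) : continuous q -> (forall x, 0 <= q x) ->
  (\int[leb2]_(x in triangle P1 P2 P3) (q x)%:E =
   (`|det3 P1 P2 P3| * \int[mu]_(r in `[0, 1])
     (r * \int[mu]_(s in `[0, 1]) q (cone P1 P2 P3 (r, s))))%:E)%E.
Proof.
move=> cq q0.
rewrite integral_mkcond.
pose G := (EFin \o q) \_ (triangle P1 P2 P3).
have mq : measurable_fun setT (q : measurableTypeR R * measurableTypeR R -> R).
  exact: continuous_measurable_prod.
have mG : measurable_fun setT (G : measurableTypeR R * measurableTypeR R -> \bar R).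
  apply/(measurable_restrictT _ measurable_triangle); apply: measurable_funTS.
  exact/measurable_EFinP.
have G0 z : (0 <= G z)%E.
  by rewrite /G patchE; case: ifP => // _; rewrite /= lee_fin.
have dd := det0; rewrite -detE in dd.
rewrite -(ge0_integral_affine2 _ _ _ _ P3.1 P3.2 G dd mG G0) detE EFinM.
congr (_ * _)%E.
have cqc : continuous (fun z => q (cone P1 P2 P3 z)).
  by move=> z; apply: (continuous_comp (continuous_cone P1 P2 P3 z)); exact: cq.
pose e r := r * \int[mu]_(s in `[0, 1]) q (cone P1 P2 P3 (r, s)).
have ce : forall r, {for r, continuous e}.
  move=> r; rewrite /e; apply: continuousM; first exact: cvg_id.
  exact: (continuous_Rintegral01 _ cqc).
(* Sections of the open triangle are open intervals; their end points do not change the integral. *)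
have finE (g : R -> R) : continuous g ->
    (\int[leb1]_(s in `]0%R, 1%R[) (g s)%:E = (\int[mu]_(s in `[0%R, 1%R]) g s)%:E)%E.
  move=> cg.
  have mg (D : set R) : measurable_fun D (EFin \o g).
    by apply: measurable_funTS; apply/measurable_EFinP; exact: continuous_measurable_fun.
  rewrite integral_itv_obnd_cbnd ?integral_itv_bndo_bndc.
  - rewrite /Rintegral fineK//; apply: integrable_fin_num => //.
    by apply: continuous_itv_integrable => s _; exact: cg.
  - exact: mg.
  - exact: mg.
rewrite -(finE e ce) [RHS]integral_mkcond; apply: eq_integral => r _.
rewrite patchE; case: ifPn => [/set_mem/=|/negP rN].
  rewrite in_itv/= => /andP[r0 r1].
  have mGr : measurable_fun setT ((fun eta => G (point r eta)) : measurableTypeR R -> \bar R).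
    pose G2 (z : R * R) := G (point z.1 z.2).
    have mG2 : measurable_fun setT (G2 : measurableTypeR R * measurableTypeR R -> \bar R).
      exact: (measurableT_comp mG (measurable_affine2 _ _ _ _ _ _)).
    have mp : measurable_fun setT ((fun eta => (r, eta))
        : measurableTypeR R -> measurableTypeR R * measurableTypeR R).
      by apply: measurable_fun_pair.
    exact: (measurableT_comp mG2 mp).
  have := ge0_integral_affine r 0 (fun eta => G (point r eta)) (lt0r_neq0 r0) mGr (fun x => G0 _).
  rewrite /point => <-; rewrite gtr0_norm// /e EFinM; congr (_ * _)%E.
  have cqr := continuous_section _ r cqc.
  rewrite -(finE _ cqr) [RHS]integral_mkcond; apply: eq_integral => s _.
  have pE : point r (r * s) = cone P1 P2 P3 (r, s).
    by rewrite /point /cone/=; congr (_, _); ring.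
  rewrite addr0 -/(point r (r * s)) /G !patchE.
  have <- : (point r (r * s) \in triangle P1 P2 P3) = (s \in `]0, 1[%classic).
    apply/idP/idP; rewrite !inE/= in_itv/=.
      move=> /triangle_point /andP[/andP[h1 h2] h3].
      by move: h1 h2; rewrite pmulr_rgt0// gtr_pMr// => -> ->.
    move=> /andP[s0 s1]; apply/triangle_point.
    by rewrite pmulr_rgt0// gtr_pMr// s0 s1.
  by rewrite /= pE.
apply: integral0_eq => eta _.
rewrite -/(point r eta) /G patchE; case: ifPn => // /set_mem.
move=> /triangle_point /andP[/andP[h1 h2] h3].
by exfalso; apply: rN; apply: mem_set; rewrite /= in_itv/= (lt_trans h1 h2).
Qed.
End triangle_integral.

(** * From smooth functions to traces *)

Lemma is_derive_mulr_arg {R : realType} (g g' : R -> R) (k s : R) :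
  (forall u : R, is_derive u 1 g (g' u)) ->
  is_derive s 1 (fun s => g (s * k)) (k * g' (s * k)).
Proof.
move=> dg.
have dk := is_derive_mul _ _ s 1 _ _ (is_derive_id s 1) (is_derive_cst k s 1).
apply: (is_derive_eq (@is_derive1_comp R g (fun s => s * k) s _ _ (dg _) dk)).
by rewrite mulr0 add0r mulr1 mulrC.
Qed.

(* FTC along the two sides of the rectangle spanned by x and x + t v gives
   f (x + t v) = f x + t (v.1 \int f_x + v.2 \int f_y), whose bracket is continuous in t *)
Lemma C1_is_derive {R : realType} (f fx fy : @pt R -> R) (x v : @pt R) :
  continuous fx -> continuous fy ->
  (forall y : @pt R, is_derive y ((1, 0) : @pt R) f (fx y)) ->
  (forall y : @pt R, is_derive y ((0, 1) : @pt R) f (fy y)) ->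
  is_derive x v f (v.1 * fx x + v.2 * fy x).
Proof.
move=> cfx cfy dfx dfy.
pose px (z : R * R) : @pt R := (x.1 + z.2 * (z.1 * v.1), x.2 + z.1 * v.2).
pose py (z : R * R) : @pt R := (x.1, x.2 + z.2 * (z.1 * v.2)).
have cpx : forall z, {for z, continuous px} by rewrite /px; solve_cont.
have cpy : forall z, {for z, continuous py} by rewrite /py; solve_cont.
have cx : continuous (fun z => fx (px z)).
  by move=> z; apply: (continuous_comp (cpx z)); exact: cfx.
have cy : continuous (fun z => fy (py z)).
  by move=> z; apply: (continuous_comp (cpy z)); exact: cfy.
pose Phi t := v.1 * \int[mu]_(s in `[0, 1]) fx (px (t, s))
  + v.2 * \int[mu]_(s in `[0, 1]) fy (py (t, s)).
have cPhi : forall t, {for t, continuous Phi}.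
  have c1 := continuous_Rintegral01 _ cx; have c2 := continuous_Rintegral01 _ cy.
  by rewrite /Phi; solve_cont.
have Phi0 : Phi 0 = v.1 * fx x + v.2 * fy x.
  rewrite /Phi; congr (_ * _ + _ * _).
    rewrite (_ : (fun s => fx (px (0, s))) = fun=> fx x) ?Rintegral01_cst//.
    by apply/funext => s; rewrite /px /= !mul0r mulr0 !addr0 -surjective_pairing.
  rewrite (_ : (fun s => fy (py (0, s))) = fun=> fy x) ?Rintegral01_cst//.
  by apply/funext => s; rewrite /py /= !mul0r mulr0 !addr0 -surjective_pairing.
have PhiE (t : R) : f (t *: v + x) - f x = t * Phi t.
  pose gx u := f ((x.1, x.2 + t * v.2) + u *: ((1, 0) : @pt R)).
  pose gy u := f (x + u *: ((0, 1) : @pt R)).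
  have Dx (s : R) : is_derive s 1 (fun s => gx (s * (t * v.1))) (t * v.1 * fx (px (t, s))).
    apply: (is_derive_eq (is_derive_mulr_arg gx _ (t * v.1) s (fun u => is_derive_line _ _ _ u _ (dfx _)))).
    congr (_ * fx _); rewrite /px; congr (_, _) => /=; rewrite /GRing.scale/= ?mulr1//.
    by rewrite mulr0 addr0.
  have Dy (s : R) : is_derive s 1 (fun s => gy (s * (t * v.2))) (t * v.2 * fy (py (t, s))).
    apply: (is_derive_eq (is_derive_mulr_arg gy _ (t * v.2) s (fun u => is_derive_line _ _ _ u _ (dfy _)))).
    congr (_ * fy _); rewrite /py; congr (_, _) => /=; rewrite /GRing.scale/= ?mulr1//.
    by rewrite mulr0 addr0.
  have cX : continuous (fun s => fx (px (t, s))) := continuous_section _ t cx.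
  have cY : continuous (fun s => fy (py (t, s))) := continuous_section _ t cy.
  have Ix : t * v.1 * \int[mu]_(s in `[0, 1]) fx (px (t, s)) =
      f (x.1 + t * v.1, x.2 + t * v.2) - f (x.1, x.2 + t * v.2).
    transitivity (\int[mu]_(s in `[0, 1])
        (t * v.1 * fx (px (t, s)) + 0 * fx (px (t, s)))).
      by rewrite Rintegral_itv_lin// mul0r addr0.
    have D (s : R) : 0 <= s <= 1 -> is_derive s 1 (fun s => gx (s * (t * v.1)))
       (t * v.1 * fx (px (t, s)) + 0 * fx (px (t, s))).
      by rewrite mul0r addr0.
    rewrite (Rintegral_FTC2 _ _ _ _ ler01 _ D).
      by rewrite /gx mul1r mul0r scale0r addr0; congr (f _ - _); congr (_, _) => /=;
        rewrite /GRing.scale/= ?mulr1 ?mulr0 ?addr0.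
    by move=> s _; solve_cont.
  have Iy : t * v.2 * \int[mu]_(s in `[0, 1]) fy (py (t, s)) =
      f (x.1, x.2 + t * v.2) - f x.
    transitivity (\int[mu]_(s in `[0, 1])
        (t * v.2 * fy (py (t, s)) + 0 * fy (py (t, s)))).
      by rewrite Rintegral_itv_lin// mul0r addr0.
    have D (s : R) : 0 <= s <= 1 -> is_derive s 1 (fun s => gy (s * (t * v.2)))
       (t * v.2 * fy (py (t, s)) + 0 * fy (py (t, s))).
      by rewrite mul0r addr0.
    rewrite (Rintegral_FTC2 _ _ _ _ ler01 _ D).
      by rewrite /gy mul1r mul0r scale0r addr0; congr (f _ - _); congr (_, _) => /=;
        rewrite /GRing.scale/= ?mulr1 ?mulr0 ?addr0.
    by move=> s _; solve_cont.
  have -> : t *: v + x = (x.1 + t * v.1, x.2 + t * v.2).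
    by rewrite addrC.
  by rewrite /Phi mulrDr !mulrA Ix Iy; ring.
have H : h^-1 *: (f (h *: v + x) - f x) @[h --> 0^'] --> v.1 * fx x + v.2 * fy x.
  rewrite -Phi0.
  have C : Phi h @[h --> 0^'] --> Phi 0 by apply: cvg_within_filter; exact: cPhi.
  apply: cvg_trans C; apply: near_eq_cvg; near=> h.
  rewrite PhiE /GRing.scale/= mulrA mulVf ?mul1r//.
  by near: h; exact: nbhs_dnbhs_neq.
apply: DeriveDef; last exact/cvg_lim.
by apply/cvg_ex; eexists; exact: H.
Unshelve. all: end_near. Qed.

(** [smooth] provides each directional derivative separately; linearity in [v] comes from the
    continuity of the two partial derivatives. *)
Lemma smooth_is_derive {R : realType} (f : @pt R -> R) (x v : @pt R) : smooth f ->
  is_derive x v f (v.1 * dx f x + v.2 * dy f x).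
Proof.
move=> sf.
apply: C1_is_derive.
- by have [] := sf [:: (1, 0)].
- by have [] := sf [:: (0, 1)].
- by move=> y; have [_ /(_ y (1, 0)) /derivableP] := sf [::].
- by move=> y; have [_ /(_ y (0, 1)) /derivableP] := sf [::].
Qed.

(** Nonnegativity gives linearity in the extended reals without integrability, so this can be used
    to establish finiteness. *)
Lemma ge0_le_integral_comb {d : measure_display} {T : measurableType d} {R : realType}
    (m : {measure set T -> \bar R}) (D : set T) (f g h : T -> R) (k l : R) :
  measurable D -> measurable_fun D f -> measurable_fun D g -> measurable_fun D h ->
  (forall x, 0 <= f x) -> (forall x, 0 <= g x) -> (forall x, 0 <= h x) ->
  0 <= k -> 0 <= l -> (forall x, D x -> f x <= k * g x + l * h x) ->
  (\int[m]_(x in D) (f x)%:E <=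
   k%:E * \int[m]_(x in D) (g x)%:E + l%:E * \int[m]_(x in D) (h x)%:E)%E.
Proof.
move=> mD mf mg mh f0 g0 h0 k0 l0 fgh.
have mg' : measurable_fun D (EFin \o g) by exact/measurable_EFinP.
have mh' : measurable_fun D (EFin \o h) by exact/measurable_EFinP.
rewrite -!ge0_integralZl//; [|by move=> x _; rewrite lee_fin..].
rewrite -ge0_integralD//; [|by move=> x _; rewrite mule_ge0// lee_fin|exact: measurable_funeM
  |by move=> x _; rewrite mule_ge0// lee_fin|exact: measurable_funeM].
apply: ge0_le_integral => //.
- by move=> x _; rewrite lee_fin.
- exact/measurable_EFinP.
- by apply: emeasurable_funD; exact: measurable_funeM.
Qed.

(** Young's inequality for [x - y = (z - y) + (x - z)]: replacing [x] by an approximation [z] costs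
    a factor [1 + e] arbitrarily close to 1. *)
Lemma sqrB_le {R : realType} (x y z e : R) : 0 < e ->
  (x - y) ^+ 2 <= (1 + e) * (z - y) ^+ 2 + (1 + e^-1) * (x - z) ^+ 2.
Proof.
move=> e0; rewrite -subr_ge0.
have -> : (1 + e) * (z - y) ^+ 2 + (1 + e^-1) * (x - z) ^+ 2 - (x - y) ^+ 2 =
  e * ((z - y) - e^-1 * (x - z)) ^+ 2 by field; rewrite gt_eqF.
by rewrite mulr_ge0 ?sqr_ge0// ltW.
Qed.

(** * Square-integrable functions of mean zero *)

Section mean_zero.
Context {R : realType}.
Notation I01 := (`[0, 1]%classic : set R).

(** The function [1 + F^2] dominates [|F|] and is integrable on the unit interval. *)
Lemma sqr_integrable (F : R -> R) : measurable_fun I01 F ->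
  (\int[leb1]_(s in I01) ((F s) ^+ 2)%:E < +oo)%E ->
  mu.-integrable I01 (EFin \o F) /\ mu.-integrable I01 (EFin \o (fun s => F s ^+ 2)).
Proof.
move=> mF F2.
have I2 : mu.-integrable I01 (EFin \o (fun s => F s ^+ 2)).
  apply/integrableP; split; first by apply/measurable_EFinP; exact: measurable_funX.
  by under eq_integral do rewrite /= ger0_norm ?sqr_ge0//.
split => //.
have I1 : mu.-integrable I01 (EFin \o (fun=> 1 : R)).
  by apply: continuous_itv_integrable => s _; exact: cvg_cst.
apply: (le_integrable _ _ _ (integrableD _ I1 I2)) => //.
  exact/measurable_EFinP.
move=> s _ /=; rewrite lee_fin [leRHS]ger0_norm ?addr_ge0 ?sqr_ge0//.
have [h|h] := lerP 0 (F s); [rewrite ger0_norm//|rewrite ltr0_norm//]; nra.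
Qed.

(** The two integrals differ by [c^2]. This allows a comparison with approximants whose own mean [c]
    need not vanish. *)
Lemma mean_zero_sqr_le (F : R -> R) (c : R) : measurable_fun I01 F ->
  (\int[leb1]_(s in I01) ((F s) ^+ 2)%:E < +oo)%E ->
  (\int[leb1]_(s in I01) (F s)%:E = 0)%E ->
  (\int[leb1]_(s in I01) ((F s) ^+ 2)%:E <=
   \int[leb1]_(s in I01) ((F s - c) ^+ 2)%:E)%E.
Proof.
move=> mF F2 F0; have [I1 I2] := sqr_integrable F mF F2.
have mI : measurable (`[0, 1]%classic : set (measurableTypeR R)) by exact: measurable_itv.
have Ic : mu.-integrable I01 (EFin \o (fun=> c ^+ 2 : R)).
  by apply: continuous_itv_integrable => s _; exact: cvg_cst.
have IcF : mu.-integrable I01 (EFin \o (fun s => (- (2 * c)) * F s)).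
  by have := integrableZl mI (- (2 * c)) I1; exact.
have -> : (\int[leb1]_(s in I01) ((F s - c) ^+ 2)%:E =
    \int[leb1]_(s in I01) ((F s) ^+ 2)%:E + (c ^+ 2)%:E)%E.
  transitivity (\int[leb1]_(s in I01)
    ((F s ^+ 2)%:E + (((- (2 * c)) * F s)%:E + (c ^+ 2)%:E)))%E.
    by apply: eq_integral => s _; rewrite -!EFinD; congr EFin; ring.
  rewrite integralD//=; last by have := integrableD mI IcF Ic; exact.
  congr (_ + _)%E; rewrite integralD//=.
  under eq_integral do rewrite EFinM.
  rewrite integralZl// F0 mule0 add0e integral_cst//=.
  by rewrite lebesgue_measure_itv/= lte_fin ltr01 oppr0 adde0 mule1.
by rewrite leeDl// lee_fin sqr_ge0.
Qed.
End mean_zero.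

Lemma len_ge0 {R : realType} (A B : @pt R) : 0 <= len A B.
Proof. exact: sqrtr_ge0. Qed.

Lemma sqr_len {R : realType} (A B : @pt R) :
  len A B ^+ 2 = (B.1 - A.1) ^+ 2 + (B.2 - A.2) ^+ 2.
Proof. by rewrite sqr_sqrtr// addr_ge0// sqr_ge0. Qed.

Lemma len_gt0 {R : realType} (P1 P2 P3 : @pt R) : det3 P1 P2 P3 != 0 -> 0 < len P1 P2.
Proof.
move=> d0; rewrite lt_def len_ge0 andbT; apply: contraNneq d0 => l0.
have := sqr_len P1 P2; rewrite l0 expr0n => /esym/eqP.
rewrite paddr_eq0 ?sqr_ge0// !sqrf_eq0 => /andP[/eqP e1 /eqP e2].
by rewrite /det3 e1 e2 mul0r mulr0 subrr.
Qed.

Lemma is_derive_lin {R : realType} (c0 a b : R) (x v : @pt R) :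
  is_derive x v (lin c0 a b) (v.1 * a + v.2 * b).
Proof.
have H : h^-1 *: (lin c0 a b (h *: v + x) - lin c0 a b x) @[h --> 0^'] -->
    v.1 * a + v.2 * b.
  have C : (fun=> v.1 * a + v.2 * b) h @[h --> (0 : R)^'] --> v.1 * a + v.2 * b.
    exact: cvg_cst.
  apply: cvg_trans C; apply: near_eq_cvg; near=> h.
  have h0 : h != 0 by near: h; exact: nbhs_dnbhs_neq.
  by rewrite /lin /= /GRing.scale/=; field.
apply: DeriveDef; last exact/cvg_lim.
by apply/cvg_ex; eexists; exact: H.
Unshelve. all: end_near. Qed.

(** The smooth estimate is applied to [un n] minus the linear polynomial. The errors [X n] on the
    edge and [Y' n] of the gradients tend to 0, while each of the two approximations costs a factor
    [1 + e]. *)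
Lemma trace_mean_zero_le {R : realType} (P1 P2 P3 : @pt R)
  (u g1 g2 : pt -> R) (t : R -> R) (c0 a b h2 : R) :
  det3 P1 P2 P3 != 0 ->
  L2 (triangle P1 P2 P3) u -> L2 (triangle P1 P2 P3) g1 -> L2 (triangle P1 P2 P3) g2 ->
  is_trace (triangle P1 P2 P3) u g1 g2 P1 P2 t ->
  (\int[leb1]_(s in `[0%R, 1%R]) (lin c0 a b (seg P1 P2 s))%:E =
   \int[leb1]_(s in `[0%R, 1%R]) (t s)%:E)%E ->
  (P2.1 - P1.1) ^+ 2 + (P2.2 - P1.2) ^+ 2 <= h2 ->
  (P3.1 - P2.1) ^+ 2 + (P3.2 - P2.2) ^+ 2 <= h2 ->
  (P1.1 - P3.1) ^+ 2 + (P1.2 - P3.2) ^+ 2 <= h2 ->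
  [/\ (\int[leb2]_(x in triangle P1 P2 P3) ((g1 x - a) ^+ 2 + (g2 x - b) ^+ 2)%:E
        < +oo)%E &
   (\int[leb1]_(s in `[0%R, 1%R]) ((t s - lin c0 a b (seg P1 P2 s)) ^+ 2)%:E <=
    ((6711 / 10000) ^+ 2 * h2 / `|det3 P1 P2 P3|)%:E *
    \int[leb2]_(x in triangle P1 P2 P3) ((g1 x - a) ^+ 2 + (g2 x - b) ^+ 2)%:E)%E].
Proof.
move=> det0 [m_u _] [mg1 _] [mg2 _] [mt t2 [un [sun cvK cve]]] tl h12 h23 h31.
set K := triangle P1 P2 P3 in m_u mg1 mg2 cvK *.
have mK : measurable (K : set (measurableTypeR R * measurableTypeR R)).
  exact: measurable_triangle.
have h20 : 0 <= h2 by apply: le_trans h12; rewrite addr_ge0// sqr_ge0.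
have dp : 0 < `|det3 P1 P2 P3| by rewrite normr_gt0.
set Einf := (\int[leb2]_(x in K) ((g1 x - a) ^+ 2 + (g2 x - b) ^+ 2)%:E)%E.
pose l s := lin c0 a b (seg P1 P2 s).
have cl : forall s, {for s, continuous l} by rewrite /l /lin /seg /=; solve_cont.
pose F s := t s - l s.
have ml : measurable_fun (`[0, 1] : set R) l.
  by apply: measurable_funTS; exact: continuous_measurable_fun.
have mF : measurable_fun (`[0, 1] : set R) F by exact: measurable_funB.
pose X n := (\int[leb1]_(s in `[0%R, 1%R]) ((un n (seg P1 P2 s) - t s) ^+ 2)%:E)%E.
pose Y n := (\int[leb2]_(x in K) ((un n x - u x) ^+ 2 + (dx (un n) x - g1 x) ^+ 2
                  + (dy (un n) x - g2 x) ^+ 2)%:E)%E.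
pose Y' n := (\int[leb2]_(x in K) ((dx (un n) x - g1 x) ^+ 2
                  + (dy (un n) x - g2 x) ^+ 2)%:E)%E.
pose q n x := (dx (un n) x - a) ^+ 2 + (dy (un n) x - b) ^+ 2.
pose E n := (\int[leb2]_(x in K) (q n x)%:E)%E.
have cun n : continuous (un n) by have [] := sun n [::].
have cdx n : continuous (dx (un n)) by have [] := sun n [:: (1, 0)].
have cdy n : continuous (dy (un n)) by have [] := sun n [:: (0, 1)].
have cseg : forall s, {for s, continuous (seg P1 P2)} by rewrite /seg; solve_cont.
have cuns n : continuous (fun s => un n (seg P1 P2 s)).
  by move=> s; apply: (continuous_comp (cseg s)); exact: cun.
have muns n : measurable_fun (`[0, 1] : set R) (fun s => un n (seg P1 P2 s)).
  by apply: measurable_funTS; exact: continuous_measurable_fun.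
have mdx n : measurable_fun (K : set (measurableTypeR R * measurableTypeR R)) (dx (un n)).
  by apply: measurable_funTS; exact: continuous_measurable_prod.
have mdy n : measurable_fun (K : set (measurableTypeR R * measurableTypeR R)) (dy (un n)).
  by apply: measurable_funTS; exact: continuous_measurable_prod.
have sqm2 (f1 f2 f3 f4 : R * R -> R) :
    measurable_fun (K : set (measurableTypeR R * measurableTypeR R)) f1 ->
    measurable_fun (K : set (measurableTypeR R * measurableTypeR R)) f2 ->
    measurable_fun (K : set (measurableTypeR R * measurableTypeR R)) f3 ->
    measurable_fun (K : set (measurableTypeR R * measurableTypeR R)) f4 ->
    measurable_fun (K : set (measurableTypeR R * measurableTypeR R))
      (fun x => (f1 x - f2 x) ^+ 2 + (f3 x - f4 x) ^+ 2).
  move=> m1 m2 m3 m4.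
  by apply: measurable_funD; apply: measurable_funX; exact: measurable_funB.
have mcst (c : R) : measurable_fun (K : set (measurableTypeR R * measurableTypeR R)) (fun=> c).
  exact: measurable_cst.
have sq2 (x y : R) : 0 <= x ^+ 2 + y ^+ 2 by rewrite addr_ge0// sqr_ge0.
have SE n : ((variance01 (fun s => un n (seg P1 P2 s) - l s))%:E <=
    (9 / 20 * h2 / `|det3 P1 P2 P3|)%:E * E n)%E /\ (E n < +oo)%E.
  have cwx : continuous (fun x => dx (un n) x - a).
    suff : forall x, {for x, continuous (fun x => dx (un n) x - a)} by [].
    by have c := cdx n; solve_cont.
  have cwy : continuous (fun x => dy (un n) x - b).
    suff : forall x, {for x, continuous (fun x => dy (un n) x - b)} by [].
    by have c := cdy n; solve_cont.
  have cw : continuous (fun x => un n x - lin c0 a b x).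
    suff : forall x, {for x, continuous (fun x => un n x - lin c0 a b x)} by [].
    by have c := cun n; rewrite /lin; solve_cont.
  have cq : continuous (q n).
    suff : forall x, {for x, continuous (q n)} by [].
    by rewrite /q; solve_cont.
  have dw (x v : @pt R) : is_derive x v (fun x => un n x - lin c0 a b x)
      (v.1 * (dx (un n) x - a) + v.2 * (dy (un n) x - b)).
    apply: (is_derive_eq (is_derive_sub _ _ _ _ _ _ (smooth_is_derive _ x v (sun n))
      (is_derive_lin c0 a b x v))).
    by ring.
  have TV := trace_variance_le P1 P2 P3 _ _ _ cw cwx cwy dw h2 h12 h23 h31.
  have IT := integral_triangle P1 P2 P3 det0 (q n) cq (fun x => sq2 _ _).
  rewrite -/K -/(E n) in IT; rewrite IT; split; last by rewrite ltry.
  rewrite -EFinM lee_fin; apply: (le_trans TV).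
  rewrite le_eqVlt; apply/orP; left; apply/eqP; rewrite /q.
  by field; rewrite gt_eqF.
have mq n := sqm2 _ _ _ _ (mdx n) (mcst a) (mdy n) (mcst b).
have mg := sqm2 _ _ _ _ mg1 (mcst a) mg2 (mcst b).
have mY n := sqm2 _ _ _ _ (mdx n) mg1 (mdy n) mg2.
have EE n (e : R) : 0 < e -> (E n <= (1 + e)%:E * Einf + (1 + e^-1)%:E * Y' n)%E.
  move=> e0; apply: (ge0_le_integral_comb _ _ _ _ _ _ _ mK (mq n) mg (mY n)) => //.
  - by rewrite addr_ge0// ltW.
  - by rewrite addr_ge0// ltW// invr_gt0.
  - move=> x _; have := sqrB_le (dx (un n) x) a (g1 x) e e0.
    by have := sqrB_le (dy (un n) x) b (g2 x) e e0; rewrite /q; lra.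
(* The converse comparison serves to show that [Einf] is finite, by way of an index where [Y' n] is
   finite. *)
have EI n : (Einf <= 2%:E * E n + 2%:E * Y' n)%E.
  apply: (ge0_le_integral_comb _ _ _ _ _ _ _ mK mg (mq n) (mY n)) => //.
  move=> x _; have := sqrB_le (g1 x) a (dx (un n) x) 1 ltr01.
  have := sqrB_le (g2 x) b (dy (un n) x) 1 ltr01.
  by rewrite /q invr1 -!(sqrrN (g1 x - dx _ _)) -!(sqrrN (g2 x - dy _ _)) !opprB; lra.
have Y'0 n : (0 <= Y' n)%E by apply: integral_ge0 => x _; rewrite lee_fin.
have mun n : measurable_fun (K : set (measurableTypeR R * measurableTypeR R)) (un n).
  by apply: measurable_funTS; exact: continuous_measurable_prod.
have Y'Y n : (Y' n <= Y n)%E.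
  apply: ge0_le_integral => //.
  - by move=> x _; rewrite lee_fin.
  - by apply/measurable_EFinP; exact: mY.
  - apply/measurable_EFinP; apply: measurable_funD.
      by apply: measurable_funD; apply: measurable_funX; exact: measurable_funB.
    by apply: measurable_funX; exact: measurable_funB.
  - by move=> x _; rewrite lee_fin -addrA lerDr sqr_ge0.
have cvY' : Y' @ \oo --> 0%E.
  apply: (@squeeze_cvge _ _ _ _ (fun=> 0%E) Y' Y) => //; last exact: cvg_cst.
  by apply: nearW => n; rewrite Y'0 Y'Y.
have Einf_fin : (Einf < +oo)%E.
  have /fine_cvgP[[n _ /(_ n (leqnn n)) /= Yn] _] := cvY'.
  apply: (le_lt_trans (EI n)); have [_ En] := SE n.
  have E0 : (0 <= E n)%E by apply: integral_ge0 => x _; rewrite lee_fin; exact: sq2.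
  rewrite lte_add_pinfty//.
    by rewrite lte_mul_pinfty.
  by rewrite lte_mul_pinfty// ltey_eq Yn.
split => //.
have mI : measurable (`[0, 1]%classic : set (measurableTypeR R)) by exact: measurable_itv.
have Il : mu.-integrable `[0, 1] (EFin \o l).
  by apply: continuous_itv_integrable => s _; exact: cl.
have l2 : (\int[leb1]_(s in `[0%R, 1%R]) (l s ^+ 2)%:E < +oo)%E.
  have : mu.-integrable `[0, 1] (EFin \o (fun s => l s ^+ 2)).
    by apply: continuous_itv_integrable => s _; solve_cont.
  by move=> /(integrable_lty mI).
have F2fin : (\int[leb1]_(s in `[0%R, 1%R]) (F s ^+ 2)%:E < +oo)%E.
  have : (\int[leb1]_(s in `[0%R, 1%R]) (F s ^+ 2)%:E <=
    2%:E * \int[leb1]_(s in `[0%R, 1%R]) (t s ^+ 2)%:E +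
    2%:E * \int[leb1]_(s in `[0%R, 1%R]) (l s ^+ 2)%:E)%E.
    apply: ge0_le_integral_comb => //; try exact: measurable_funX.
    - by move=> s; exact: sqr_ge0.
    - by move=> s; exact: sqr_ge0.
    - by move=> s; exact: sqr_ge0.
    - by move=> s _; have := sqr_ge0 (t s + l s); rewrite /F; lra.
  by move=> /le_lt_trans; apply; apply: lte_add_pinfty; rewrite lte_mul_pinfty.
have F0 : (\int[leb1]_(s in `[0%R, 1%R]) (F s)%:E = 0)%E.
  have [It _] := sqr_integrable t mt t2.
  under eq_integral do rewrite EFinB.
  rewrite integralB_EFin// -tl subee//.
  exact: (integrable_fin_num mI Il).
(* The slack: [9/20 * (1 + 1/2500)^2 = 0.45036...], while [0.6711^2 = 0.45037...]. *)
have [e [e0 ele]] : exists e : R, 0 < e /\ (1 + e) ^+ 2 * 9 / 20 <= (6711 / 10000) ^+ 2.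
  by exists (1 / 2500); split; lra.
have e1 : 0 <= 1 + e by rewrite addr_ge0// ltW.
have e2 : 0 <= 1 + e^-1 by rewrite addr_ge0// invr_ge0 ltW.
have Fn n : (\int[leb1]_(s in `[0%R, 1%R]) (F s ^+ 2)%:E <=
    (1 + e)%:E * (variance01 (fun s => un n (seg P1 P2 s) - l s))%:E
    + (1 + e^-1)%:E * X n)%E.
  pose w s := un n (seg P1 P2 s) - l s.
  have cw : forall s, {for s, continuous w} by have c := cuns n; rewrite /w; solve_cont.
  (* Centring at the mean of [w] turns the second moment into the variance bounded by [SE]. *)
  pose c := \int[mu]_(s in `[0, 1]) w s.
  have V : (\int[leb1]_(s in `[0%R, 1%R]) ((w s - c) ^+ 2)%:E)%E = (variance01 w)%:E.
    have := Rintegral01_sqrB w c cw; rewrite subrr expr0n addr0 => <-.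
    rewrite /Rintegral fineK//; apply: integrable_fin_num => //.
    by apply: continuous_itv_integrable => s _; solve_cont.
  apply: (le_trans (mean_zero_sqr_le F c mF F2fin F0)).
  have mw : measurable_fun (`[0, 1] : set R) w by exact: measurable_funB.
  have mFc : measurable_fun (`[0, 1] : set R) (fun s => (F s - c) ^+ 2).
    by apply: measurable_funX; exact: measurable_funB.
  have mwc : measurable_fun (`[0, 1] : set R) (fun s => (w s - c) ^+ 2).
    by apply: measurable_funX; exact: measurable_funB.
  have mX : measurable_fun (`[0, 1] : set R) (fun s => (un n (seg P1 P2 s) - t s) ^+ 2).
    by apply: measurable_funX; exact: measurable_funB.
  rewrite -V; apply: (ge0_le_integral_comb _ _ _ _ _ _ _ mI mFc mwc mX).
  - by move=> s; exact: sqr_ge0.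
  - by move=> s; exact: sqr_ge0.
  - by move=> s; exact: sqr_ge0.
  - exact: e1.
  - exact: e2.
  - move=> s _; apply: (le_trans (sqrB_le (F s) c (w s) e e0)).
    rewrite lerD2l ler_wpM2l//.
    have -> : F s - w s = - (un n (seg P1 P2 s) - t s) by rewrite /F /w; ring.
    by rewrite sqrrN.
pose C0 := 9 / 20 * h2 / `|det3 P1 P2 P3|.
have C00 : 0 <= C0 by rewrite divr_ge0 ?mulr_ge0.
have Einf0 : (0 <= Einf)%E by apply: integral_ge0 => x _; rewrite lee_fin; exact: sq2.
(* The first term is independent of [n], and the other two vanish in the limit. *)
pose rhs n := (((1 + e) ^+ 2 * C0)%:E * Einf +
   (((1 + e) * C0 * (1 + e^-1))%:E * Y' n + (1 + e^-1)%:E * X n))%E.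
have Fr n : (\int[leb1]_(s in `[0%R, 1%R]) (F s ^+ 2)%:E <= rhs n)%E.
  apply: (le_trans (Fn n)); rewrite /rhs addeA leeD2r//.
  have [SEn _] := SE n.
  have EEn := EE n _ e0.
  have : ((1 + e)%:E * (variance01 (fun s => un n (seg P1 P2 s) - l s))%:E <=
     (1 + e)%:E * (C0%:E * ((1 + e)%:E * Einf + (1 + e^-1)%:E * Y' n)))%E.
    apply: lee_wpmul2l; first by rewrite lee_fin.
    by apply: (le_trans SEn); apply: lee_wpmul2l.
  move=> /le_trans; apply.
  rewrite [(C0%:E * _)%E]ge0_muleDr ?mule_ge0 ?lee_fin//.
  rewrite ge0_muleDr ?mule_ge0 ?lee_fin//.
  rewrite !muleA -!EFinM le_eqVlt; apply/orP; left; apply/eqP.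
  by congr (_%:E * _ + _%:E * _)%E; ring.
have cvr : rhs @ \oo --> (((1 + e) ^+ 2 * C0)%:E * Einf + (0 + 0))%E.
  apply: cvgeD; first by rewrite adde0 fin_num_adde_defl.
    exact: cvg_cst.
  apply: cvgeD => //.
    by rewrite -[X in _ --> X](mule0 ((1 + e) * C0 * (1 + e^-1))%:E); exact: cvgeZl.
  by rewrite -[X in _ --> X](mule0 (1 + e^-1)%:E); exact: cvgeZl.
have : (\int[leb1]_(s in `[0%R, 1%R]) (F s ^+ 2)%:E <=
    ((1 + e) ^+ 2 * C0)%:E * Einf + (0 + 0))%E.
  by apply: cvge_ge cvr; apply: nearW => n; exact: Fr.
rewrite !adde0 => /le_trans; apply.
by rewrite lee_wpmul2r// lee_fin /C0 !mulrA ler_pM2r ?invr_gt0// ler_wpM2r.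
Qed.

(** * The estimate in terms of longest edge and height *)

Theorem theorem3p3 (R : realType) (P1 P2 P3 : @pt R)
  (u g1 g2 : pt -> R) (t1 t2 t3 : R -> R) (c0 a b : R) :
  det3 P1 P2 P3 != 0 ->
  H1_weak_grad (triangle P1 P2 P3) u g1 g2 ->
  (* traces of u on e1 = P1P2, e2 = P2P3, e3 = P3P1 *)
  is_trace (triangle P1 P2 P3) u g1 g2 P1 P2 t1 ->
  is_trace (triangle P1 P2 P3) u g1 g2 P2 P3 t2 ->
  is_trace (triangle P1 P2 P3) u g1 g2 P3 P1 t3 ->
  (* Pi_h u = lin c0 a b is the Crouzeix--Raviart interpolant of u *)
  line_int P1 P2 (fun s => lin c0 a b (seg P1 P2 s)) = line_int P1 P2 t1 ->
  line_int P2 P3 (fun s => lin c0 a b (seg P2 P3 s)) = line_int P2 P3 t2 ->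
  line_int P3 P1 (fun s => lin c0 a b (seg P3 P1 s)) = line_int P3 P1 t3 ->
  let hK := Num.max (len P1 P2) (Num.max (len P2 P3) (len P3 P1)) in
  let HK := 2 * area P1 P2 P3 / len P1 P2 in
  Num.sqrt (fine (line_int P1 P2 (fun s => (t1 s - lin c0 a b (seg P1 P2 s)) ^+ 2)))
  <= 6711 / 10000 * (hK / Num.sqrt HK) *
     Num.sqrt (fine (\int[leb2]_(x in triangle P1 P2 P3)
                       ((g1 x - a) ^+ 2 + (g2 x - b) ^+ 2)%:E)%E).
Proof.
move=> det0 [Lu Lg1 Lg2 _] tr1 _ _ mean1 _ _; lazy zeta.
set hK := Num.max _ _; set HK := 2 * _ / _.
have l0 : 0 < len P1 P2 := len_gt0 P1 P2 P3 det0.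
have dp : 0 < `|det3 P1 P2 P3| by rewrite normr_gt0.
have hl (A B : @pt R) : len A B <= hK ->
    (B.1 - A.1) ^+ 2 + (B.2 - A.2) ^+ 2 <= hK ^+ 2.
  by move=> h; rewrite -sqr_len ler_sqr// ?nnegrE ?len_ge0// (le_trans _ h)// len_ge0.
have h12 : len P1 P2 <= hK by rewrite /hK le_max lexx.
have h23 : len P2 P3 <= hK by rewrite /hK !le_max lexx orbT.
have h31 : len P3 P1 <= hK by rewrite /hK !le_max lexx !orbT.
have hK0 : 0 <= hK by apply: le_trans h12; exact: len_ge0.
have mean : (\int[leb1]_(s in `[0%R, 1%R]) (lin c0 a b (seg P1 P2 s))%:E =
   \int[leb1]_(s in `[0%R, 1%R]) (t1 s)%:E)%E.
  have l0E : ((len P1 P2)^-1%:E * (len P1 P2)%:E = 1 :> \bar R)%E.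
    by rewrite -EFinM mulVf// gt_eqF.
  have := congr1 (fun x => (len P1 P2)^-1%:E * x)%E mean1.
  by rewrite /line_int !muleA l0E !mul1e.
have [Efin main] := trace_mean_zero_le P1 P2 P3 u g1 g2 t1 c0 a b (hK ^+ 2) det0
  Lu Lg1 Lg2 tr1 mean (hl _ _ h12) (hl _ _ h23) (hl _ _ h31).
set E := (\int[leb2]_(x in _) _)%E in Efin main *.
set F := (\int[leb1]_(s in _) _)%E in main.
have E0 : (0 <= E)%E.
  by apply: integral_ge0 => x _; rewrite lee_fin addr_ge0// sqr_ge0.
have F0 : (0 <= F)%E by apply: integral_ge0 => x _; rewrite lee_fin sqr_ge0.
(* Since [fine] sends infinity to 0, both integrals must be finite before passing to real
   numbers. *)
have EE : E = (fine E)%:E by rewrite fineK// ge0_fin_numE.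
have FF : F = (fine F)%:E.
  rewrite fineK// ge0_fin_numE//; apply: (le_lt_trans main).
  by rewrite EE -EFinM ltry.
have FE : fine F <= (6711 / 10000) ^+ 2 * hK ^+ 2 / `|det3 P1 P2 P3| * fine E.
  by rewrite -lee_fin EFinM -EE -FF.
(* Twice the area is [|det|], so the factor [|e| hK^2 / |det|] of the squared estimate equals
   [hK^2 / HK]. *)
have HKE : HK = `|det3 P1 P2 P3| / len P1 P2.
  by rewrite /HK /area mulrCA divff// mulr1.
have HK0 : 0 < HK by rewrite HKE divr_gt0.
have e0 : 0 <= fine E by exact: fine_ge0.
rewrite /line_int -/F FF -EFinM /=.
(* The numeral is generalized to a symbol for the algebra that follows. *)
set c : R := 6711 / 10000 in FE *.
have c_ge0 : 0 <= c by exact: divr_ge0 (ler0n _ _) (ler0n _ _).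
move: c c_ge0 FE => c c_ge0 FE.
set rhs := (leRHS).
have rhs0 : 0 <= rhs.
  by rewrite /rhs !mulr_ge0 ?divr_ge0 ?invr_ge0 ?sqrtr_ge0.
rewrite -[leRHS]ger0_norm// -sqrtr_sqr ler_wsqrtr//.
rewrite /rhs !exprMn exprVn !sqr_sqrtr ?(ltW HK0)//.
rewrite HKE; apply: (le_trans (ler_wpM2l (ltW l0) FE)).
rewrite le_eqVlt; apply/orP; left; apply/eqP.
by field; rewrite !gt_eqF.
Qed.
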